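(* Let $R$ and $S$ be associative rings and let ${}_SC_R$ be a semidualizing $(S,R)$-bimodule. (a) The class $\mathcal{F}_C(S)$ is closed under coproducts, filtered colimits and direct summands. If $R$ is right coherent, then $\mathcal{F}_C(S)$ is also closed under products. (b) The class $\mathcal{P}_C(S)$ is closed under coproducts and direct summands. (c) The class $\mathcal{I}_C(R)$ is closed under products and direct summands. If $S$ is left noetherian, then $\mathcal{I}_C(R)$ is also closed under coproducts and filtered colimits.
   Context: Rings are associative with unity (not necessarily commutative or noetherian). Modules are unital left modules; right $R$-modules are identified with left $R^{\mathrm{op}}$-modules. An $(S,R)$-bimodule $C={}_SC_R$ is semidualizing if: (a1) ${}_SC$ admits a degreewise finite $S$-projective resolution (a projective resolution by finitely generated projectives); (a2) $C_R$ admits a degreewise finite $R^{\mathrm{op}}$-projective resolution; (b1) the homothety map $S\to\operatorname{Hom}_{R^{\mathrm{op}}}(C,C)$, $s\mapsto(x\mapsto sx)$, is an isomorphism; (b2) the homothety map $R\to\operatorname{Hom}_S(C,C)$, $r\mapsto(x\mapsto xr)$, is an isomorphism; (c1) $\operatorname{Ext}_S^{i}(C,C)=0$ for all $i\geq1$; (c2) $\operatorname{Ext}_{R^{\mathrm{op}}}^{i}(C,C)=0$ for all $i\geq 1$. $\mathcal{F}_C(S)=\{C\otimes_RF\mid {}_RF\text{ flat}\}$, $\mathcal{P}_C(S)=\{C\otimes_RP\mid {}_RP\text{ projective}\}$, $\mathcal{I}_C(R)=\{\operatorname{Hom}_S(C,I)\mid {}_SI\text{ injective}\}$ (closed under isomorphism).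 *)

(* Defs.v *)
From HB Require Import structures.
From mathcomp Require Import all_boot all_order all_algebra.

Set Implicit Arguments.
Unset Strict Implicit.
Unset Printing Implicit Defensive.

Import GRing.Theory.
Local Open Scope ring_scope.

(* Rings are [pzRingType]s: associative with unity, possibly noncommutative,  *)
(* possibly zero. A left module over A is an [lmodType A]; a right R-module   *)
(* is an [lmodType R^c], so that [r *: x] stands for the product x r.         *)

Section Modules.
Variable A : pzRingType.

Definition surjective (U V : lmodType A) (f : {linear U -> V}) : Prop :=
  forall y, exists x, f x = y.

Definition exact (U V W : lmodType A)
    (f : {linear U -> V}) (g : {linear V -> W}) : Prop :=
  forall y, g y = 0 <-> exists x, f x = y.

Definition projective (P : lmodType A) : Prop :=
  forall (U V : lmodType A) (p : {linear U -> V}) (f : {linear P -> V}),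
    surjective p -> exists g : {linear P -> U}, forall x, p (g x) = f x.

Definition injective_module (E : lmodType A) : Prop :=
  forall (U V : lmodType A) (i : {linear U -> V}) (f : {linear U -> E}),
    injective i -> exists g : {linear V -> E}, forall x, g (i x) = f x.

Definition finitely_generated (M : lmodType A) : Prop :=
  exists (n : nat) (g : {linear 'rV[A]_n -> M}), surjective g.

Definition finitely_presented (M : lmodType A) : Prop :=
  exists (m n : nat) (f : {linear 'rV[A]_m -> 'rV[A]_n})
         (g : {linear 'rV[A]_n -> M}), exact f g /\ surjective g.

(* Left ideals of A are presented as linear injections J -> A^o. *)
Definition left_noetherian : Prop :=
  forall (J : lmodType A) (i : {linear J -> A^o}),
    injective i -> finitely_generated J.

Definition left_coherent : Prop :=
  forall (J : lmodType A) (i : {linear J -> A^o}),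
    injective i -> finitely_generated J -> finitely_presented J.

(* ... -> P 2 -> P 1 -> P 0 -> M -> 0 *)
Record projective_resolution (M : lmodType A) := ProjectiveResolution {
  res_obj : nat -> lmodType A;
  res_diff : forall n, {linear res_obj n.+1 -> res_obj n};
  res_aug : {linear res_obj 0 -> M};
  res_projective : forall n, projective (res_obj n);
  res_aug_surj : surjective res_aug;
  res_exact0 : exact (res_diff 0) res_aug;
  res_exactS : forall n, exact (res_diff n.+1) (res_diff n)
}.

Definition degreewise_finite (M : lmodType A) (P : projective_resolution M) :
    Prop :=
  forall n, finitely_generated (res_obj P n).

(* Degree-i cocycles and coboundaries of the complex Hom_A(P, N). *)
Definition cocycle (M N : lmodType A) (P : projective_resolution M) (i : nat)
    (f : {linear res_obj P i -> N}) : Prop :=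
  forall x, f (res_diff P i x) = 0.

Definition coboundary (M N : lmodType A) (P : projective_resolution M)
    (i : nat) : {linear res_obj P i -> N} -> Prop :=
  match i with
  | 0 => fun f => forall x, f x = 0
  | k.+1 => fun f => exists g : {linear res_obj P k -> N},
                       forall x, f x = g (res_diff P k x)
  end.

(* Ext_A^i(M, N) = 0, with Ext computed from any projective resolution of M. *)
Definition ext_vanishes (i : nat) (M N : lmodType A) : Prop :=
  forall (P : projective_resolution M) (f : {linear res_obj P i -> N}),
    cocycle f -> coboundary f.

End Modules.

Definition right_coherent (R : pzRingType) : Prop := left_coherent R^c.

Section Tensor.
Variable R : pzRingType.

Definition balanced (U : lmodType R^c) (F : lmodType R) (T : zmodType)
    (t : U -> F -> T) : Prop :=
  [/\ forall u u' x, t (u + u') x = t u x + t u' x,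
      forall u x x', t u (x + x') = t u x + t u x'
    & forall u (r : R) x, t ((r : R^c) *: u) x = t u (r *: x)].

(* (T, t) is a tensor product of U and F over R: t is the universal balanced  *)
(* map.                                                                       *)
Definition is_tensor (U : lmodType R^c) (F : lmodType R) (T : zmodType)
    (t : U -> F -> T) : Prop :=
  balanced t /\
  forall (G : zmodType) (g : U -> F -> G), balanced g ->
    exists h : {additive T -> G},
      (forall u x, h (t u x) = g u x) /\
      (forall h' : {additive T -> G},
         (forall u x, h' (t u x) = g u x) -> h' =1 h).

(* The map h below is the one that i induces from U (x) F to V (x) F. *)
Definition flat (F : lmodType R) : Prop :=
  forall (U V : lmodType R^c) (i : {linear U -> V}), injective i ->
  forall (T : zmodType) (t : U -> F -> T) (T' : zmodType) (t' : V -> F -> T'),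
    is_tensor t -> is_tensor t' ->
  forall h : {additive T -> T'},
    (forall u x, h (t u x) = t' (i u) x) -> injective h.

End Tensor.

(* [bimod_act x r] is the product x r. *)
Record bimodule (S R : pzRingType) := Bimodule {
  bimod_left :> lmodType S;
  bimod_act : bimod_left -> R -> bimod_left;
  bimod_actDl : forall x y r,
    bimod_act (x + y) r = bimod_act x r + bimod_act y r;
  bimod_actDr : forall x r r',
    bimod_act x (r + r') = bimod_act x r + bimod_act x r';
  bimod_actM : forall x r r',
    bimod_act x (r * r') = bimod_act (bimod_act x r) r';
  bimod_act1 : forall x, bimod_act x 1 = x;
  bimod_actZ : forall (s : S) x r,
    bimod_act (s *: x) r = s *: bimod_act x r
}.

Section RightModule.
Variables (S R : pzRingType) (C : bimodule S R).

Definition bimod_right : Type := C.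

HB.instance Definition _ := GRing.Zmodule.on bimod_right.

Definition right_scale (r : R^c) (x : bimod_right) : bimod_right :=
  bimod_act (x : C) (r : R).

Fact right_scaleA (a b : R^c) (x : bimod_right) :
  right_scale a (right_scale b x) = right_scale (a * b) x.
Proof. by rewrite /right_scale -bimod_actM. Qed.

Fact right_scale1 : left_id 1 right_scale.
Proof. by move=> x; apply: bimod_act1. Qed.

Fact right_scaleDr : right_distributive right_scale +%R.
Proof. by move=> r x y; apply: bimod_actDl. Qed.

Fact right_scaleDl (x : bimod_right) : {morph right_scale^~ x : a b / a + b}.
Proof. by move=> a b; apply: bimod_actDr. Qed.

HB.instance Definition _ := GRing.Zmodule_isLmodule.Build R^c bimod_right
  right_scaleA right_scale1 right_scaleDr right_scaleDl.

End RightModule.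

Section Semidualizing.
Variables (S R : pzRingType) (C : bimodule S R).

(* The homothety maps are automatically ring homomorphisms, so it is enough   *)
(* to ask that they be bijective.                                             *)
Record semidualizing : Prop := Semidualizing {
  sd_left_finite : exists P : projective_resolution (bimod_left C),
            degreewise_finite P;
  sd_right_finite : exists P : projective_resolution (bimod_right C),
            degreewise_finite P;
  sd_left_homothety : forall f : {linear bimod_right C -> bimod_right C},
            exists! s : S, forall x : C, f x = s *: x;
  sd_right_homothety : forall f : {linear C -> C},
            exists! r : R, forall x : C, f x = bimod_act x r;
  sd_left_ext : forall i : nat, (1 <= i)%N ->
            ext_vanishes i (bimod_left C) (bimod_left C);
  sd_right_ext : forall i : nat, (1 <= i)%N ->
            ext_vanishes i (bimod_right C) (bimod_right C)
}.

(* M is isomorphic, as a left S-module, to the tensor product of C and F      *)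
(* over R.                                                                    *)
Definition is_left_tensor (F : lmodType R) (M : lmodType S) : Prop :=
  exists t : bimod_right C -> F -> M,
    is_tensor t /\
    (forall (s : S) (c : C) (x : F), t (s *: c) x = s *: t c x).

(* N is isomorphic, as a left R-module, to Hom_S(C, E), on which R acts by    *)
(* (r f)(c) = f (c r).                                                        *)
Definition is_left_hom (E : lmodType S) (N : lmodType R) : Prop :=
  exists phi : N -> {linear C -> E},
    [/\ forall x y c, phi (x + y) c = phi x c + phi y c,
        forall (r : R) x c, phi (r *: x) c = phi x (bimod_act c r)
      & forall f : {linear C -> E}, exists! x, phi x =1 f].

Definition flat_C (M : lmodType S) : Prop :=
  exists2 F : lmodType R, flat F & is_left_tensor F M.

Definition projective_C (M : lmodType S) : Prop :=
  exists2 P : lmodType R, projective P & is_left_tensor P M.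

Definition injective_C (N : lmodType R) : Prop :=
  exists2 E : lmodType S, injective_module E & is_left_hom E N.

End Semidualizing.

Record small_category := SmallCategory {
  cat_ob :> Type;
  cat_hom : cat_ob -> cat_ob -> Type;
  cat_id : forall i, cat_hom i i;
  cat_comp : forall i j k, cat_hom i j -> cat_hom j k -> cat_hom i k;
  cat_id_comp : forall i j (u : cat_hom i j), cat_comp (cat_id i) u = u;
  cat_comp_id : forall i j (u : cat_hom i j), cat_comp u (cat_id j) = u;
  cat_compA : forall i j k l
    (u : cat_hom i j) (v : cat_hom j k) (w : cat_hom k l),
    cat_comp u (cat_comp v w) = cat_comp (cat_comp u v) w
}.

Definition filtered (J : small_category) : Prop :=
  [/\ inhabited J,
      forall i j : J, exists k : J,
        inhabited (cat_hom i k) /\ inhabited (cat_hom j k)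
    & forall (i j : J) (u v : cat_hom i j), exists (k : J) (w : cat_hom j k),
        cat_comp u w = cat_comp v w].

Section Closure.
Variable A : pzRingType.

Record diagram (J : small_category) := Diagram {
  diag_ob :> J -> lmodType A;
  diag_map : forall i j, cat_hom i j -> {linear diag_ob i -> diag_ob j};
  diag_map_id : forall i x, diag_map (cat_id i) x = x;
  diag_map_comp : forall i j k (u : cat_hom i j) (v : cat_hom j k) x,
    diag_map (cat_comp u v) x = diag_map v (diag_map u x)
}.

Definition is_cocone (J : small_category) (D : diagram J) (L : lmodType A)
    (g : forall i, {linear D i -> L}) : Prop :=
  forall i j (u : cat_hom i j) x, g j (diag_map D u x) = g i x.

Definition is_colimit (J : small_category) (D : diagram J) (L : lmodType A)
    (g : forall i, {linear D i -> L}) : Prop :=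
  is_cocone g /\
  forall (N : lmodType A) (f : forall i, {linear D i -> N}), is_cocone f ->
    exists h : {linear L -> N},
      (forall i x, h (g i x) = f i x) /\
      (forall h' : {linear L -> N},
         (forall i x, h' (g i x) = f i x) -> h' =1 h).

Definition is_coproduct (I : Type) (M : I -> lmodType A) (L : lmodType A)
    (g : forall i, {linear M i -> L}) : Prop :=
  forall (N : lmodType A) (f : forall i, {linear M i -> N}),
    exists h : {linear L -> N},
      (forall i x, h (g i x) = f i x) /\
      (forall h' : {linear L -> N},
         (forall i x, h' (g i x) = f i x) -> h' =1 h).

Definition is_product (I : Type) (M : I -> lmodType A) (L : lmodType A)
    (p : forall i, {linear L -> M i}) : Prop :=
  forall (N : lmodType A) (f : forall i, {linear N -> M i}),
    exists h : {linear N -> L},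
      (forall i x, p i (h x) = f i x) /\
      (forall h' : {linear N -> L},
         (forall i x, p i (h' x) = f i x) -> h' =1 h).

Definition direct_summand (K M : lmodType A) : Prop :=
  exists (K' : lmodType A) (f : {linear (K * K')%type -> M}), bijective f.

Definition closed_under_coproducts (X : lmodType A -> Prop) : Prop :=
  forall (I : Type) (M : I -> lmodType A) (L : lmodType A)
         (g : forall i, {linear M i -> L}),
    (forall i, X (M i)) -> is_coproduct g -> X L.

Definition closed_under_products (X : lmodType A -> Prop) : Prop :=
  forall (I : Type) (M : I -> lmodType A) (L : lmodType A)
         (p : forall i, {linear L -> M i}),
    (forall i, X (M i)) -> is_product p -> X L.

Definition closed_under_filtered_colimits (X : lmodType A -> Prop) : Prop :=
  forall (J : small_category) (D : diagram J) (L : lmodType A)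
         (g : forall i, {linear D i -> L}),
    filtered J -> (forall i, X (D i)) -> is_colimit g -> X L.

Definition closed_under_direct_summands (X : lmodType A -> Prop) : Prop :=
  forall K M : lmodType A, X M -> direct_summand K M -> X K.

End Closure.

(* Main.v *)
(* Two facts carry the argument. If F is flat, then F -> Hom_S(C, C (x) F) is
   bijective, because C is finitely presented over S and End_S(C) = R. If E is
   injective, then every R-linear map Hom_S(C, E) -> Hom_S(C, E') is induced by
   a unique S-linear map E -> E', because C is finitely presented over R and
   End_R(C) = S. Hence summands and filtered colimits in the three classes come
   from summands and filtered colimits of flat, projective or injective
   modules. Coproducts and products need only that C (x) - commutes with
   coproducts, Hom_S(C, -) with products, C (x) - with products (C is finitely
   presented over R) and Hom_S(C, -) with coproducts (C is finitely generated
   over S). *)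

Require Import Defs.
From HB Require Import structures.
From mathcomp Require Import all_boot all_order all_algebra.
From mathcomp Require Import boolp classical_sets.

Set Implicit Arguments.
Unset Strict Implicit.
Unset Printing Implicit Defensive.

Import GRing.Theory.
Local Open Scope ring_scope.

(** * Submodules, products and direct sums *)

(** The definition of [flat] tests all injections against all tensor products, which is hard to use
    on elements. It is replaced by the equational criterion [eqflat]: a finite relation sum r_i x_i
    = 0 comes from a factorization x = a y with r a = 0. Such data pass to retracts, to direct sums
    and, when the relations among the r_i are finitely generated, to products. For flat F the same
    kind of factorization kills finitely many relations between tensors at once, and this is how the
    generators and relations of C over S are exploited. Tensor products and colimits are given by
    universal properties only, so a concrete model of each is built in order to read off when an
    element vanishes. On the injective side no tensor product is formed: that C (x) Hom_S(C, E) is E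
    is expressed by relations among the values alpha(c), through exactness of Hom(-, E) on 0 -> S ->
    C^K -> C^L. Over a noetherian ring, injectivity of direct sums and filtered colimits rests on
    Baer's criterion, obtained from Zorn's lemma. *)

Lemma dep_choice (I : Type) (T : I -> Type) (P : forall i, T i -> Prop) :
  (forall i, exists x, P i x) -> exists f : forall i, T i, forall i, P i (f i).
Proof. by move=> /(_ _)/cid E; exists (fun i => sval (E i)) => i; apply: svalP. Qed.

Definition mklinear (A : pzRingType) (U V : lmodType A) (f : U -> V)
    (Hf : linear f) : {linear U -> V} :=
  HB.pack f (GRing.isLinear.Build A U V *:%R f Hf).

Lemma morphD_zmod (U V : zmodType) (f : U -> V) :
  {morph f : x y / x + y} -> zmod_morphism f.
Proof.
move=> fD x y; have f0 : f 0 = 0 by apply: (addrI (f 0)); rewrite -fD !addr0.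
by rewrite fD; congr (_ + _); apply: (addrI (f y)); rewrite -fD !subrr.
Qed.

Definition mkadditive (U V : zmodType) (f : U -> V)
    (fD : {morph f : x y / x + y}) : {additive U -> V} :=
  HB.pack f (GRing.isZmodMorphism.Build U V f (morphD_zmod fD)).

(** Bundled maps carry proofs, so proof irrelevance is needed. Equality of the records themselves
    matters because they are the elements of Hom_S(C, L) below. *)
Lemma linear_ext (A : pzRingType) (U V : lmodType A) (f g : {linear U -> V}) :
  f =1 g -> f = g.
Proof.
move: f g => [f [[fD] [fZ]]] [g [[gD] [gZ]]] /= /funext E; subst g.
by rewrite (Prop_irrelevance fD gD) (Prop_irrelevance fZ gZ).
Qed.

Section Submodules.
Variables (A : pzRingType) (M : lmodType A).

Record submod := Submod {
  submod_pred :> M -> Prop;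
  submod0 : submod_pred 0;
  submodD : forall x y, submod_pred x -> submod_pred y -> submod_pred (x + y);
  submodZ : forall a x, submod_pred x -> submod_pred (a *: x)
}.

Lemma submodN (P : submod) x : P x -> P (- x).
Proof. by move=> Px; rewrite -scaleN1r; apply: submodZ. Qed.

Lemma submod_sum (P : submod) (I : Type) (r : seq I) (f : I -> M) :
  (forall i, P (f i)) -> P (\sum_(i <- r) f i).
Proof. by move=> Pf; apply: big_ind => //; [exact: submod0 | exact: submodD]. Qed.

Variable P : submod.

Definition submod_of : Type := {x : M | P x}.

HB.instance Definition _ := gen_eqMixin submod_of.
HB.instance Definition _ := gen_choiceMixin submod_of.

Lemma submod_of_eq (x y : submod_of) : sval x = sval y -> x = y.
Proof. by case: x y => [x Px] [y Py] /= E; apply: eq_exist. Qed.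

Definition sm_zero : submod_of := exist _ 0 (submod0 P).
Definition sm_add (x y : submod_of) : submod_of :=
  exist _ (sval x + sval y) (submodD (svalP x) (svalP y)).
Definition sm_opp (x : submod_of) : submod_of :=
  exist _ (- sval x) (submodN (svalP x)).
Definition sm_scale (a : A) (x : submod_of) : submod_of :=
  exist _ (a *: sval x) (submodZ a (svalP x)).

Fact sm_addA : associative sm_add.
Proof. by move=> x y z; apply: submod_of_eq; rewrite /= addrA. Qed.
Fact sm_addC : commutative sm_add.
Proof. by move=> x y; apply: submod_of_eq; rewrite /= addrC. Qed.
Fact sm_add0 : left_id sm_zero sm_add.
Proof. by move=> x; apply: submod_of_eq; rewrite /= add0r. Qed.
Fact sm_addN : left_inverse sm_zero sm_opp sm_add.
Proof. by move=> x; apply: submod_of_eq; rewrite /= addNr. Qed.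
HB.instance Definition _ :=
  GRing.isZmodule.Build submod_of sm_addA sm_addC sm_add0 sm_addN.

Fact sm_scaleA a b (x : submod_of) :
  sm_scale a (sm_scale b x) = sm_scale (a * b) x.
Proof. by apply: submod_of_eq; rewrite /= scalerA. Qed.
Fact sm_scale1 : left_id 1 sm_scale.
Proof. by move=> x; apply: submod_of_eq; rewrite /= scale1r. Qed.
Fact sm_scaleDr : right_distributive sm_scale +%R.
Proof. by move=> a x y; apply: submod_of_eq; rewrite /= scalerDr. Qed.
Fact sm_scaleDl (x : submod_of) : {morph sm_scale^~ x : a b / a + b}.
Proof. by move=> a b; apply: submod_of_eq; rewrite /= scalerDl. Qed.
HB.instance Definition _ := GRing.Zmodule_isLmodule.Build A submod_of
  sm_scaleA sm_scale1 sm_scaleDr sm_scaleDl.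

Fact sm_val_linear : linear (fun x : submod_of => sval x).
Proof. by []. Qed.
Definition submod_val : {linear submod_of -> M} := mklinear sm_val_linear.

Lemma submod_val_inj : injective submod_val.
Proof. exact: submod_of_eq. Qed.

Lemma submod_of_sum (I : Type) (r : seq I) (f : I -> submod_of) :
  sval (\sum_(i <- r) f i) = \sum_(i <- r) sval (f i).
Proof. exact: (raddf_sum submod_val). Qed.

Section Corestriction.
Variables (U : lmodType A) (f : {linear U -> M}) (Pf : forall x, P (f x)).
Fact corestr_linear : linear (fun x => exist _ (f x) (Pf x) : submod_of).
Proof. by move=> a x y; apply: submod_of_eq; rewrite /= linearP. Qed.
Definition corestr : {linear U -> submod_of} := mklinear corestr_linear.
End Corestriction.
End Submodules.

Section Products.
Variables (A : pzRingType) (I : Type) (M : I -> lmodType A).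

Definition prodm : Type := forall i, M i.

HB.instance Definition _ := gen_eqMixin prodm.
HB.instance Definition _ := gen_choiceMixin prodm.

Definition pm_zero : prodm := fun i => 0.
Definition pm_add (x y : prodm) : prodm := fun i => x i + y i.
Definition pm_opp (x : prodm) : prodm := fun i => - x i.
Definition pm_scale (a : A) (x : prodm) : prodm := fun i => a *: x i.

Fact pm_addA : associative pm_add.
Proof. by move=> x y z; apply: functional_extensionality_dep => i; apply: addrA. Qed.
Fact pm_addC : commutative pm_add.
Proof. by move=> x y; apply: functional_extensionality_dep => i; apply: addrC. Qed.
Fact pm_add0 : left_id pm_zero pm_add.
Proof. by move=> x; apply: functional_extensionality_dep => i; apply: add0r. Qed.
Fact pm_addN : left_inverse pm_zero pm_opp pm_add.
Proof. by move=> x; apply: functional_extensionality_dep => i; apply: addNr. Qed.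
HB.instance Definition _ :=
  GRing.isZmodule.Build prodm pm_addA pm_addC pm_add0 pm_addN.

Fact pm_scaleA a b (x : prodm) :
  pm_scale a (pm_scale b x) = pm_scale (a * b) x.
Proof. by apply: functional_extensionality_dep => i; apply: scalerA. Qed.
Fact pm_scale1 : left_id 1 pm_scale.
Proof. by move=> x; apply: functional_extensionality_dep => i; apply: scale1r. Qed.
Fact pm_scaleDr : right_distributive pm_scale +%R.
Proof. by move=> a x y; apply: functional_extensionality_dep => i; apply: scalerDr. Qed.
Fact pm_scaleDl (x : prodm) : {morph pm_scale^~ x : a b / a + b}.
Proof. by move=> a b; apply: functional_extensionality_dep => i; apply: scalerDl. Qed.
HB.instance Definition _ := GRing.Zmodule_isLmodule.Build A prodm
  pm_scaleA pm_scale1 pm_scaleDr pm_scaleDl.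

Fact pm_proj_linear i : linear (fun x : prodm => x i).
Proof. by []. Qed.
Definition prodm_proj i : {linear prodm -> M i} := mklinear (@pm_proj_linear i).

Lemma prodm_sum (J : Type) (r : seq J) (f : J -> prodm) i :
  (\sum_(j <- r) f j) i = \sum_(j <- r) f j i.
Proof. exact: (raddf_sum (prodm_proj i)). Qed.

Section Pairing.
Variables (U : lmodType A) (f : forall i, {linear U -> M i}).
Fact prodm_pair_linear : linear (fun x => (fun i => f i x) : prodm).
Proof.
by move=> a x y; apply: functional_extensionality_dep => i /=; rewrite linearP.
Qed.
Definition prodm_pair : {linear U -> prodm} := mklinear prodm_pair_linear.
End Pairing.
End Products.

Section DirectSums.
Variables (A : pzRingType) (I : Type) (M : I -> lmodType A).

(** The index type is arbitrary; [{classic I}] gives it a decidable equality, so that supports can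
    be lists with boolean membership. *)
Definition supported (s : seq {classic I}) (x : prodm M) :=
  forall i : {classic I}, i \notin s -> x i = 0.

Fact fsupp0 : exists s, supported s 0.
Proof. by exists [::]. Qed.
Fact fsuppD (x y : prodm M) :
  (exists s, supported s x) -> (exists s, supported s y) ->
  exists s, supported s (x + y).
Proof.
move=> [s sx] [s' sy]; exists (s ++ s') => i.
rewrite mem_cat negb_or => /andP[/sx xi /sy yi].
by rewrite -[(x + y) i]/(x i + y i) xi yi addr0.
Qed.
Fact fsuppZ a (x : prodm M) :
  (exists s, supported s x) -> exists s, supported s (a *: x).
Proof.
move=> [s sx]; exists s => i /sx xi.
by rewrite -[(a *: x) i]/(a *: x i) xi scaler0.
Qed.

Definition fsupp : submod (prodm M) := Submod fsupp0 fsuppD fsuppZ.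

Definition dsum : lmodType A := submod_of fsupp.

Definition coord (x : dsum) (i : I) : M i := sval x i.

Lemma dsum_eq (x y : dsum) : (forall i, coord x i = coord y i) -> x = y.
Proof.
by move=> E; apply/submod_of_eq/functional_extensionality_dep => i; apply: E.
Qed.

Lemma coordD x y i : coord (x + y) i = coord x i + coord y i.
Proof. by []. Qed.
Lemma coordN x i : coord (- x) i = - coord x i.
Proof. by []. Qed.
Lemma coordZ a x i : coord (a *: x) i = a *: coord x i.
Proof. by []. Qed.
Lemma coord0 i : coord 0 i = 0.
Proof. by []. Qed.
Lemma coord_sum (J : Type) (r : seq J) (f : J -> dsum) i :
  coord (\sum_(j <- r) f j) i = \sum_(j <- r) coord (f j) i.
Proof. by elim/big_rec2: _ => // j y z _ <-. Qed.

Lemma dsum_support (x : dsum) :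
  {s : seq {classic I} | uniq s & supported s (sval x)}.
Proof.
have /cid[s sx] := svalP x; exists (undup s); first exact: undup_uniq.
by move=> i; rewrite mem_undup; apply: sx.
Qed.

Definition inj_fun i (x : M i) : prodm M :=
  @dfwith {classic I} M (fun=> 0) i x.

Fact inj_supported i (x : M i) : fsupp (inj_fun x).
Proof.
exists [:: i : {classic I}] => j; rewrite inE => ji.
by rewrite /inj_fun (@dfwith_out {classic I}) // eq_sym.
Qed.

Fact dinj_linear i : linear (fun x : M i => exist _ _ (inj_supported x) : dsum).
Proof.
move=> a x y; apply: dsum_eq => j.
rewrite coordD coordZ /coord /= /inj_fun.
have [<-|ij] := pselect (i = j); first by rewrite !(@dfwith_in {classic I}).
by rewrite !(@dfwith_out {classic I}) ?scaler0 ?addr0 //; apply/eqP.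
Qed.
Definition dinj i : {linear M i -> dsum} := mklinear (@dinj_linear i).

Lemma coord_in i (x : M i) : coord (dinj i x) i = x.
Proof. by rewrite /coord /= /inj_fun (@dfwith_in {classic I}). Qed.
Lemma coord_out i (x : M i) j : i <> j -> coord (dinj i x) j = 0.
Proof.
by move=> ij; rewrite /coord /= /inj_fun (@dfwith_out {classic I}) //; apply/eqP.
Qed.

Lemma dsum_decomp (x : dsum) (s : seq {classic I}) :
  uniq s -> supported s (sval x) -> x = \sum_(i <- s) dinj i (coord x i).
Proof.
move=> us sx; apply: dsum_eq => i; rewrite coord_sum.
have [is_|nis] := boolP ((i : {classic I}) \in s).
  rewrite (bigD1_seq (i : {classic I})) // coord_in big1 => [|j /eqP ji].
    by rewrite /= addr0.
  exact: coord_out.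
rewrite [LHS]sx // big_seq big1 // => j js; apply: coord_out => ji.
by move: nis; rewrite -ji js.
Qed.

Section Lift.
Variable (G : zmodType) (f : forall i, {additive M i -> G}).

Definition dlift_fun (x : dsum) : G :=
  \sum_(i <- s2val (dsum_support x)) f i (coord x i).

(** Two supports of [x] become permutations of each other once the indices contributing zero are
    dropped, so the support chosen in [dlift_fun] is immaterial. *)
Lemma dlift_fun_supp (x : dsum) (s : seq {classic I}) :
    uniq s -> supported s (sval x) ->
  dlift_fun x = \sum_(i <- s) f i (coord x i).
Proof.
move=> us sx; rewrite /dlift_fun; case: (dsum_support x) => s' us' sx' /=.
pose p (i : {classic I}) := f i (coord x i) != 0.
have restr (r : seq {classic I}) :
    \sum_(i <- r) f i (coord x i) = \sum_(i <- [seq i <- r | p i]) f i (coord x i).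
  by rewrite big_filter [LHS](bigID p) /= [X in _ + X]big1 ?addr0 // => i /negPn/eqP.
rewrite (restr s') (restr s); apply: perm_big; apply: uniq_perm; rewrite ?filter_uniq //.
move=> i; rewrite !mem_filter; have [pi|//] := boolP (p i); rewrite /=.
have inS (r : seq {classic I}) : supported r (sval x) -> i \in r.
  by move=> rx; apply: contraTT pi => /rx E; rewrite /p negbK /coord E raddf0.
by rewrite !inS.
Qed.

Fact dlift_morph : {morph dlift_fun : x y / x + y}.
Proof.
move=> x y; have [s us sx] := dsum_support x; have [s' us' sy] := dsum_support y.
have sub (z : dsum) (r : seq {classic I}) :
    supported r (sval z) -> {subset r <= s ++ s'} ->
    supported (undup (s ++ s')) (sval z).
  by move=> rz rs i; rewrite mem_undup => /(contra (rs i)) /rz.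
have xs : supported (undup (s ++ s')) (sval x).
  by apply: sub sx _ => i; rewrite mem_cat => ->.
have ys : supported (undup (s ++ s')) (sval y).
  by apply: sub sy _ => i; rewrite mem_cat orbC => ->.
rewrite !(@dlift_fun_supp _ (undup (s ++ s'))) ?undup_uniq //.
  by rewrite -big_split; apply: eq_bigr => i _; rewrite coordD raddfD.
move=> i /[dup] /xs xi /ys yi.
by rewrite -[LHS]/(sval x i + sval y i) xi yi addr0.
Qed.
Definition dlift : {additive dsum -> G} := mkadditive dlift_morph.

Lemma dlift_supp (x : dsum) (s : seq {classic I}) :
    uniq s -> supported s (sval x) ->
  dlift x = \sum_(i <- s) f i (coord x i).
Proof. exact: dlift_fun_supp. Qed.

Lemma dlift_inj i (x : M i) : dlift (dinj i x) = f i x.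
Proof.
rewrite (@dlift_supp _ [:: i : {classic I}]) //; first by rewrite big_seq1 coord_in.
by move=> j; rewrite inE => /eqP ji; apply: coord_out => /esym.
Qed.
End Lift.

Lemma dsum_ext (G : zmodType) (h h' : {additive dsum -> G}) :
  (forall i x, h (dinj i x) = h' (dinj i x)) -> h =1 h'.
Proof.
move=> E x; have [s us sx] := dsum_support x.
by rewrite (dsum_decomp us sx) !raddf_sum; apply: eq_bigr.
Qed.

Lemma dsum_ext' (G : zmodType) (h h' : dsum -> G) :
  {morph h : x y / x + y} -> {morph h' : x y / x + y} ->
  (forall i x, h (dinj i x) = h' (dinj i x)) -> forall x, h x = h' x.
Proof. by move=> hD h'D E x; apply: (@dsum_ext _ (mkadditive hD) (mkadditive h'D)). Qed.

Section LinearLift.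
Variables (N : lmodType A) (f : forall i, {linear M i -> N}).
Fact dllift_linear : linear (dlift f).
Proof.
move=> a x y; rewrite raddfD; congr (_ + _).
have [s us sx] := dsum_support x.
rewrite !(@dlift_supp _ _ _ s) //.
  rewrite scaler_sumr; apply: eq_bigr => i _; rewrite coordZ.
    exact: (linearZ_LR (f i)).
by move=> i /sx xi; rewrite -[LHS]/(a *: sval x i) xi scaler0.
Qed.
Definition dllift : {linear dsum -> N} := mklinear dllift_linear.
Lemma dllift_inj i (x : M i) : dllift (dinj i x) = f i x.
Proof. exact: (dlift_inj f). Qed.
End LinearLift.

Fact coord_linear i : linear (fun x => coord x i).
Proof. by []. Qed.
Definition dproj i : {linear dsum -> M i} := mklinear (@coord_linear i).
End DirectSums.
Arguments dinj {A I M} i.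
Arguments coord_sum {A I M J}.
Arguments coord : simpl never.
Arguments dinj : simpl never.
Arguments dlift : simpl never.
Arguments dllift : simpl never.
Arguments dproj : simpl never.

Section Finite.
Variables (A : pzRingType) (I : finType) (M : I -> lmodType A).

Lemma mem_classic (K : eqType) (s : seq K) (i : K) :
  ((i : {classic K}) \in (s : seq {classic K})) = (i \in s).
Proof.
elim: s => // j s IH; rewrite !inE IH; congr orb.
by apply/eqP/eqP.
Qed.

Lemma uniq_classic (K : eqType) (s : seq K) :
  uniq (s : seq {classic K}) = uniq s.
Proof. by elim: s => //= j s ->; rewrite mem_classic. Qed.

Lemma supported_enum (x : prodm M) : supported (enum I : seq {classic I}) x.
Proof. by move=> i; rewrite mem_classic mem_enum. Qed.

Lemma dlift_fin (G : zmodType) (f : forall i, {additive M i -> G}) (x : dsum M) :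
  dlift f x = \sum_i f i (coord x i).
Proof.
rewrite (dlift_supp _ (s := enum I : seq {classic I})) ?uniq_classic ?enum_uniq //.
  exact: (big_enum _ _ predT).
exact: supported_enum.
Qed.

Lemma coord_dsum_tuple (x : prodm M) i : coord (\sum_j dinj j (x j)) i = x i.
Proof.
rewrite coord_sum (bigD1 i) // coord_in big1 => [|j /eqP ji]; first by rewrite /= addr0.
exact: coord_out.
Qed.
End Finite.

Lemma common_support (A : pzRingType) (I : Type) (M : I -> lmodType A)
    (K : finType) (x : K -> dsum M) :
  exists s : seq {classic I}, uniq s /\
    forall k (i : {classic I}), i \notin s -> coord (x k) i = 0.
Proof.
have /choice[sp spP] : forall k, exists s : seq {classic I},
    forall i : {classic I}, i \notin s -> coord (x k) i = 0.
  by move=> k; have [s _ sx] := dsum_support (x k); exists s.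
exists (undup (flatten [seq sp k | k <- enum K])); split; first exact: undup_uniq.
move=> k i; rewrite mem_undup => ni; apply: spP; apply: contra ni => ik.
by apply/flattenP; exists (sp k) => //; apply/mapP; exists k; rewrite ?mem_enum.
Qed.

(** * Tensor products *)

Section Quotients.
Variable G : zmodType.

Record subgroup := Subgroup {
  subgroup_pred :> G -> Prop;
  subgroup0 : subgroup_pred 0;
  subgroupB : forall x y, subgroup_pred x -> subgroup_pred y -> subgroup_pred (x - y)
}.

Variable P : subgroup.

Lemma subgroupN x : P x -> P (- x).
Proof. by move=> Px; rewrite -sub0r; apply: subgroupB => //; apply: subgroup0. Qed.
Lemma subgroupD x y : P x -> P y -> P (x + y).
Proof. by move=> Px /subgroupN Py; rewrite -[y]opprK; apply: subgroupB. Qed.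

(** Cosets are kept as predicates on [G]: function and propositional extensionality then turn
    equality of classes into membership of the difference in [P]. *)
Definition quot : Type := {X : G -> Prop | exists x, X = (fun y => P (y - x))}.

HB.instance Definition _ := gen_eqMixin quot.
HB.instance Definition _ := gen_choiceMixin quot.

Definition qclass (x : G) : quot :=
  exist _ (fun y => P (y - x)) (ex_intro _ x erefl).

Lemma qclass_eq x y : qclass x = qclass y <-> P (x - y).
Proof.
split=> [E|Pxy].
  have: sval (qclass y) x by rewrite -E /= subrr; apply: subgroup0.
  by [].
apply: eq_exist; apply: funext => z; apply: propext; split => Pz.
  by rewrite -(subrK x z) -addrA; apply: subgroupD.
by rewrite -(subrK y z) -addrA; apply: subgroupD => //; rewrite -opprB; apply: subgroupN.
Qed.

Lemma qrep_ex (X : quot) : exists x, qclass x = X.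
Proof. by case: X => X [x Xx]; exists x; apply: eq_exist. Qed.
Definition qrep X := sval (cid (qrep_ex X)).
Lemma qrepK X : qclass (qrep X) = X.
Proof. exact: svalP (cid (qrep_ex X)). Qed.

Definition q_add X Y := qclass (qrep X + qrep Y).
Definition q_opp X := qclass (- qrep X).

Lemma q_addE x y : q_add (qclass x) (qclass y) = qclass (x + y).
Proof.
apply/qclass_eq; rewrite opprD addrACA; apply: subgroupD; apply/qclass_eq; exact: qrepK.
Qed.
Lemma q_oppE x : q_opp (qclass x) = qclass (- x).
Proof.
apply/qclass_eq; rewrite -opprD; apply: subgroupN; apply/qclass_eq; exact: qrepK.
Qed.

Fact q_addA : associative q_add.
Proof.
by move=> X Y Z; rewrite -(qrepK X) -(qrepK Y) -(qrepK Z) !q_addE addrA.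
Qed.
Fact q_addC : commutative q_add.
Proof. by move=> X Y; rewrite /q_add addrC. Qed.
Fact q_add0 : left_id (qclass 0) q_add.
Proof. by move=> X; rewrite -(qrepK X) q_addE add0r. Qed.
Fact q_addN : left_inverse (qclass 0) q_opp q_add.
Proof. by move=> X; rewrite -(qrepK X) q_oppE q_addE addNr. Qed.
HB.instance Definition _ :=
  GRing.isZmodule.Build quot q_addA q_addC q_add0 q_addN.

Fact qproj_morph : {morph qclass : x y / x + y}.
Proof. by move=> x y; rewrite -q_addE. Qed.
Definition qproj : {additive G -> quot} := mkadditive qproj_morph.
Arguments qproj : simpl never.

Lemma qproj_eq0 x : qproj x = 0 <-> P x.
Proof. by rewrite -{2}(subr0 x); apply: qclass_eq. Qed.
Lemma qproj_surj X : exists x, qproj x = X.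
Proof. exact: qrep_ex. Qed.

Section QLift.
Variables (H : zmodType) (f : {additive G -> H}) (f0 : forall x, P x -> f x = 0).
Lemma qlift_rep x : f (qrep (qproj x)) = f x.
Proof.
apply/eqP; rewrite -subr_eq0 -raddfB; apply/eqP/f0/qclass_eq; exact: qrepK.
Qed.
Fact qlift_morph : {morph (fun X => f (qrep X)) : X Y / X + Y}.
Proof.
move=> X Y; case: (qproj_surj X) => x <-; case: (qproj_surj Y) => y <-.
by rewrite -raddfD !qlift_rep raddfD.
Qed.
Definition qlift : {additive quot -> H} := mkadditive qlift_morph.
Arguments qlift : simpl never.
Lemma qliftE x : qlift (qproj x) = f x.
Proof. exact: qlift_rep. Qed.
End QLift.
End Quotients.

Section Balanced.
Variables (R : pzRingType) (V : lmodType R^c) (F : lmodType R) (G : zmodType).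
Variables (g : V -> F -> G) (hg : balanced g).

Fact balanced_morph v : {morph g v : x y / x + y}.
Proof. by case: hg => _ + _; apply. Qed.

Lemma balanced0l x : g 0 x = 0.
Proof. by case: hg => gDl _ _; apply: (addrI (g 0 x)); rewrite -gDl !addr0. Qed.

Lemma balanced_suml (I : Type) (s : seq I) (v : I -> V) x :
  g (\sum_(i <- s) v i) x = \sum_(i <- s) g (v i) x.
Proof.
have [gDl _ _] := hg.
exact: (raddf_sum (mkadditive (fun u u' => gDl u u' x : (g^~ x) (u + u') = _))).
Qed.

Lemma balanced_sumr (I : Type) (s : seq I) v (x : I -> F) :
  g v (\sum_(i <- s) x i) = \sum_(i <- s) g v (x i).
Proof. exact: (raddf_sum (mkadditive (balanced_morph v))). Qed.
End Balanced.

(* For a generating family c : J -> V, the tensor product of V and F is the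
   quotient of F^(J) by K.F, where K is the kernel of eps : R^(J) -> V. Keeping
   c arbitrary gives both the description by finitely many generators and the
   vanishing criterion for prescribed elements of V. *)
Section TensorConstruction.
Variables (R : pzRingType) (V : lmodType R^c) (F : lmodType R).
Variables (J : Type) (c : J -> V).

Definition coefs : lmodType R^c := dsum (fun _ : J => (R^c)^o : lmodType R^c).

Fact scale_at_linear j : linear (fun r : (R^c)^o => (r : R^c) *: c j).
Proof. by move=> a x y; rewrite scalerDl scalerA. Qed.
Definition eps : {linear coefs -> V} :=
  dllift (fun j => mklinear (scale_at_linear j)).
Arguments eps : simpl never.

Lemma eps_inj j (r : R^c) : eps (dinj j (r : (R^c)^o)) = r *: c j.
Proof. exact: dllift_inj. Qed.

Definition generating := forall v, exists k, eps k = v.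

Definition vecs : lmodType R := dsum (fun _ : J => F).

Fact act_supported (k : coefs) (y : F) :
  @fsupp R J (fun=> F) (fun j => (coord k j : R) *: y).
Proof.
have [s us sk] := dsum_support k; exists s => i /sk ki.
by rewrite /coord ki; apply: scale0r.
Qed.
Definition act (k : coefs) (y : F) : vecs := exist _ _ (act_supported k y).

Lemma coord_act k y j : coord (act k y) j = (coord k j : R) *: y.
Proof. by []. Qed.
Lemma actDl k k' y : act (k + k') y = act k y + act k' y.
Proof. by apply: dsum_eq => j; rewrite coordD !coord_act -scalerDl. Qed.
Lemma actDr k y y' : act k (y + y') = act k y + act k y'.
Proof. by apply: dsum_eq => j; rewrite coordD !coord_act scalerDr. Qed.
Lemma actN k y : act k (- y) = - act k y.
Proof. by apply: dsum_eq => j; rewrite coordN !coord_act scalerN. Qed.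
Lemma actZ k (r : R) y : act ((r : R^c) *: k) y = act k (r *: y).
Proof. by apply: dsum_eq => j; rewrite !coord_act scalerA. Qed.
Lemma act_inj j (r : R) y : act (dinj j (r : (R^c)^o)) y = dinj j (r *: y).
Proof.
apply: dsum_eq => i; rewrite coord_act.
have [<-|ij] := pselect (j = i); first by rewrite !coord_in.
by rewrite !coord_out //; apply: scale0r.
Qed.

Definition relations (psi : vecs) := exists2 s : seq (coefs * F),
  (forall p, p \in s -> eps p.1 = 0) & psi = \sum_(p <- s) act p.1 p.2.

Fact relations0 : relations 0.
Proof. by exists [::]; rewrite ?big_nil. Qed.
Fact relationsB psi psi' : relations psi -> relations psi' -> relations (psi - psi').
Proof.
move=> [s s0 ->] [s' s'0 ->]; exists (s ++ [seq (p.1, - p.2) | p <- s']).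
  by move=> p; rewrite mem_cat => /orP[/s0//|/mapP[q /s'0 q0 ->]].
rewrite big_cat big_map /= -sumrN; congr (_ + _).
by apply: eq_bigr => p _; rewrite actN.
Qed.
Definition rel_subgroup := Subgroup relations0 relationsB.

Definition tens : zmodType := quot rel_subgroup.

Lemma relations1 k y : eps k = 0 -> relations (act k y).
Proof.
by exists [:: (k, y)]; rewrite ?big_seq1 // => p; rewrite inE => /eqP ->.
Qed.

Section LiftBalanced.
Variables (G : zmodType) (g : V -> F -> G) (hg : balanced g).
Definition tlift : {additive vecs -> G} :=
  dlift (fun j => mkadditive (balanced_morph hg (c j))).
Arguments tlift : simpl never.
Lemma tlift_inj j x : tlift (dinj j x) = g (c j) x.
Proof. exact: dlift_inj. Qed.
Lemma tlift_act k y : tlift (act k y) = g (eps k) y.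
Proof.
have [gDl gDr gZ] := hg.
have mD : {morph (fun k => tlift (act k y)) : k k' / k + k'}.
  by move=> k1 k2; rewrite actDl raddfD.
have mE : {morph (fun k => g (eps k) y) : k k' / k + k'}.
  by move=> k1 k2; rewrite linearD gDl.
apply: (@dsum_ext _ _ _ _ (mkadditive mD) (mkadditive mE)) => j r.
change (tlift (act (dinj j (r : (R^c)^o)) y) = g (eps (dinj j (r : (R^c)^o))) y).
by rewrite act_inj tlift_inj eps_inj gZ.
Qed.
Lemma tlift_rel psi : rel_subgroup psi -> tlift psi = 0.
Proof.
move=> [s s0 ->]; rewrite raddf_sum big_seq big1 // => p ps.
by rewrite tlift_act s0 // balanced0l.
Qed.
End LiftBalanced.

Hypothesis cgen : generating.

Definition tens_pure (v : V) (x : F) : tens :=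
  qproj rel_subgroup (act (sval (cid (cgen v))) x).

(** Two preimages of [v] differ by an element of the kernel of [eps], and such an element acting on
    [x] is a relation. Hence the chosen preimage is immaterial. *)
Lemma tens_pureE v x k : eps k = v -> tens_pure v x = qproj rel_subgroup (act k x).
Proof.
move=> kv; apply/eqP; rewrite -subr_eq0 -raddfB; apply/eqP/qproj_eq0.
have -> (k' : coefs) : act k' x - act k x = act (k' - k) x.
  by rewrite actDl; congr (_ + _); apply: dsum_eq => j; rewrite coordN !coord_act coordN scaleNr.
by apply: relations1; rewrite linearB kv (svalP (cid (cgen v))) subrr.
Qed.

Lemma tens_pure_gen j x : tens_pure (c j) x = qproj rel_subgroup (dinj j x).
Proof.
have E : eps (dinj j (1 : (R^c)^o)) = c j by rewrite eps_inj scale1r.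
by rewrite (tens_pureE _ E) act_inj scale1r.
Qed.

Lemma tens_balanced : balanced tens_pure.
Proof.
split=> [u u' x|u x x'|u r x].
- have [k ku] := cgen u; have [k' ku'] := cgen u'.
  have E : eps (k + k') = u + u' by rewrite linearD ku ku'.
  by rewrite (tens_pureE _ E) (tens_pureE _ ku) (tens_pureE _ ku') actDl raddfD.
- by rewrite /tens_pure actDr raddfD.
- have [k ku] := cgen u.
  have E : eps ((r : R^c) *: k) = (r : R^c) *: u by rewrite linearZ_LR ku.
  by rewrite (tens_pureE _ E) (tens_pureE _ ku) actZ.
Qed.

Lemma tens_is_tensor : is_tensor tens_pure.
Proof.
split; first exact: tens_balanced.
move=> G g hg; exists (qlift (tlift_rel hg)); split=> [u x|h' h'g X].
  by have [k ku] := cgen u; rewrite (tens_pureE _ ku) qliftE tlift_act ku.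
have [psi <-] := qproj_surj X; rewrite qliftE; move: psi.
apply: (@dsum_ext _ _ _ _ (h' \o qproj rel_subgroup : {additive _ -> _})) => j x.
by rewrite tlift_inj -h'g tens_pure_gen.
Qed.

Section AnyTensor.
Variables (T : zmodType) (t : V -> F -> T) (ht : is_tensor t).

(** The universal property of [T] maps it to the concrete quotient, where vanishing means lying in
    [relations] by construction. *)
Lemma tensor_vanish psi : tlift ht.1 psi = 0 -> relations psi.
Proof.
move=> psi0; have [h [ht0 _]] := ht.2 _ _ tens_balanced.
apply/(qproj_eq0 rel_subgroup); rewrite -[RHS](raddf0 h) -psi0; move: psi {psi0}.
apply: (@dsum_ext _ _ _ _ _ (h \o tlift ht.1 : {additive _ -> _})) => j x.
by rewrite -tens_pure_gen -ht0 -(tlift_inj ht.1).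
Qed.

(** The composite of [T] to the concrete quotient and back fixes every [t u x], so it is the
    identity by uniqueness; the quotient is covered by [vecs]. *)
Lemma tensor_generated z : exists psi, z = tlift ht.1 psi.
Proof.
have [h [ht0 _]] := ht.2 _ _ tens_balanced.
have [h' [h't _]] := tens_is_tensor.2 _ _ ht.1.
have [id' [_ idU]] := ht.2 _ _ ht.1.
have [psi psiE] := qproj_surj (h z); exists psi.
have E : h' (h z) = z.
  rewrite [RHS](idU idfun) // -(idU (h' \o h : {additive _ -> _})) // => u x /=.
  by rewrite ht0 h't.
rewrite -E -psiE; move: psi {psiE}.
apply: (@dsum_ext _ _ _ _ (h' \o qproj rel_subgroup : {additive _ -> _})) => j x.
by rewrite tlift_inj -h't tens_pure_gen.
Qed.
End AnyTensor.
End TensorConstruction.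

(** * Flat modules *)

(* The equational criterion for flatness: every linear relation in F is a
   consequence of relations in R. *)
Definition eqflat (R : pzRingType) (F : lmodType R) :=
  forall (I : finType) (r : I -> R) (x : I -> F), \sum_i r i *: x i = 0 ->
  exists (K : finType) (a : I -> K -> R) (y : K -> F),
    (forall i, x i = \sum_k a i k *: y k) /\
    (forall k, \sum_i r i * a i k = 0).

Section Flatness.
Variables (R : pzRingType) (F : lmodType R).

Lemma relations_fin (V : lmodType R^c) (J : Type) (c : J -> V)
    (psi : vecs F J) : relations c psi ->
  exists (n : nat) (k : 'I_n -> coefs R J) (y : 'I_n -> F),
    (forall a, eps c (k a) = 0) /\ psi = \sum_a act (k a) (y a).
Proof.
move=> [s s0 ->]; exists (size s).
exists (fun a => (tnth (in_tuple s) a).1), (fun a => (tnth (in_tuple s) a).2).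
split=> [a|]; last by rewrite big_tnth.
by apply: s0; apply: mem_tnth.
Qed.

Fact regular_scale_balanced :
  balanced (fun (s : (R^c)^o) (x : F) => (s : R) *: x).
Proof.
by split=> [s s' x|s x x'|s r x]; rewrite ?scalerDl ?scalerDr //= scalerA.
Qed.

Lemma regular_is_tensor :
  is_tensor (fun (s : (R^c)^o : lmodType R^c) (x : F) => (s : R) *: x).
Proof.
split; first exact: regular_scale_balanced.
move=> G g [gDl gDr gZ].
have gD : {morph g 1 : x y / x + y} by move=> x y; apply: gDr.
exists (mkadditive gD); split=> [s x|h' h'g x] /=; last by rewrite -h'g scale1r.
by rewrite -gZ; congr g; apply: (mulr1 (s : R^c)).
Qed.

Section Image.
Variables (I : finType) (r : I -> R).
Definition in_right_ideal (s : (R^c)^o) := exists a : I -> R, (s : R) = \sum_i r i * a i.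
Fact right_ideal0 : in_right_ideal 0.
Proof. by exists (fun=> 0); rewrite big1 // => i _; rewrite mulr0. Qed.
Fact right_idealD s s' : in_right_ideal s -> in_right_ideal s' -> in_right_ideal (s + s').
Proof.
move=> [a sa] [a' s'a]; exists (fun i => a i + a' i).
rewrite -[LHS]/((s : R) + (s' : R)) sa s'a -big_split.
by apply: eq_bigr => i _; rewrite mulrDr.
Qed.
Fact right_idealZ (b : R^c) s : in_right_ideal s -> in_right_ideal (b *: s).
Proof.
move=> [a sa]; exists (fun i => a i * (b : R)).
rewrite -[LHS]/((s : R) * (b : R)) sa mulr_suml.
by apply: eq_bigr => i _; rewrite mulrA.
Qed.
Definition right_ideal : submod ((R^c)^o : lmodType R^c) :=
  Submod right_ideal0 right_idealD right_idealZ.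
End Image.

Lemma right_ideal_gen (I : finType) (r : I -> R) i : right_ideal r (r i).
Proof.
exists (fun j => (j == i)%:R); rewrite (bigD1 i) //= eqxx mulr1 big1 ?addr0 //.
by move=> j /negPf ->; rewrite mulr0.
Qed.

Lemma eps_fin (V : lmodType R^c) (I : finType) (c : I -> V) (k : coefs R I) :
  eps c k = \sum_i (coord k i : R^c) *: c i.
Proof. exact: dlift_fin. Qed.

(** Flatness is applied to the inclusion in R of the right ideal J generated by the r_i. Injectivity
    of J (x) F -> F makes the sum of the r_i (x) x_i vanish, and the model of J (x) F on the
    generators r_i then writes x through syzygies of r. *)
Lemma flat_eqflat : flat F -> eqflat F.
Proof.
move=> Fflat I r x rx0.
pose U : lmodType R^c := submod_of (right_ideal r).
pose c i : U := exist _ _ (right_ideal_gen r i).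
have cgen : generating c.
  move=> [s [a sa]]; exists (\sum_i dinj i (a i : (R^c)^o)).
  apply: submod_of_eq; rewrite linear_sum submod_of_sum [RHS]sa.
  apply: eq_bigr => i _; rewrite eps_inj; exact: erefl.
have tT := tens_is_tensor F cgen; have tR := regular_is_tensor.
have bal : balanced (fun (u : U) (y : F) => (sval u : R) *: y).
  have [sDl sDr sZ] := regular_scale_balanced.
  by split=> [u u' y|u y y'|u b y]; [apply: sDl|apply: sDr|apply: sZ].
have [h [hE _]] := tT.2 _ _ bal.
have hinj := Fflat _ _ (submod_val (right_ideal r)) (@submod_val_inj _ _ _) _ _ _ _ tT tR h hE.
pose psi : vecs F I := \sum_i dinj i (x i).
have psiR : relations c psi.
  apply/(qproj_eq0 (rel_subgroup F c)); apply: hinj; rewrite raddf0.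
  rewrite -[RHS]rx0 !raddf_sum; apply: eq_bigr => i _.
  by rewrite -tens_pure_gen hE.
have [n [k [y [k0 psiE]]]] := relations_fin psiR.
exists 'I_n, (fun i a => coord (k a) i : R), y; split=> [i|a].
  rewrite -[LHS](coord_dsum_tuple (M := fun=> F) x i).
  by rewrite -/psi psiE coord_sum; apply: eq_bigr => a _; rewrite coord_act.
have := congr1 (fun u : U => sval u) (k0 a).
by rewrite eps_fin submod_of_sum.
Qed.

(** Induction on the relations: a factorization x = a y kills the first, and the others become
    relations on y with coefficients r a. Multiplying matrices on the right preserves the equations
    already solved, and no relation at all is served by the identity matrix. *)
Lemma eqflat_system (K : eqType) (s : seq K) (I : finType) (r : K -> I -> R)
    (x : I -> F) : eqflat F ->
    (forall q, q \in s -> \sum_i r q i *: x i = 0) ->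
  exists (L : finType) (a : I -> L -> R) (y : L -> F),
    (forall i, x i = \sum_l a i l *: y l) /\
    (forall q, q \in s -> forall l, \sum_i r q i * a i l = 0).
Proof.
move=> Ff; elim: s I r x => [|q s IH] I r x rx.
  exists I, (fun i j => (i == j)%:R), x; split=> // i.
  rewrite (bigD1 i) //= eqxx scale1r big1 ?addr0 // => j.
  by rewrite eq_sym => /negPf ->; rewrite scale0r.
have [L [a [y [xE ra]]]] := Ff I (r q) x (rx q (mem_head q s)).
have [|L' [a' [y' [yE ra']]]] := IH L (fun p l => \sum_i r p i * a i l) y.
  move=> p ps; rewrite -[RHS](rx p) ?inE ?ps ?orbT //.
  under eq_bigr do rewrite scaler_suml.
  rewrite exchange_big; apply: eq_bigr => i _; rewrite xE scaler_sumr.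
  by apply: eq_bigr => l _; rewrite scalerA.
have assoc (v : I -> R) l' : \sum_i v i * (\sum_l a i l * a' l l') =
    \sum_l (\sum_i v i * a i l) * a' l l'.
  under eq_bigr do rewrite mulr_sumr; under [RHS]eq_bigr do rewrite mulr_suml.
  by rewrite exchange_big; do 2!apply: eq_bigr => ? _; rewrite mulrA.
exists L', (fun i l' => \sum_l a i l * a' l l'), y'; split=> [i|p ps l'].
  rewrite xE; under eq_bigr do rewrite yE scaler_sumr.
  rewrite exchange_big; apply: eq_bigr => l' _; rewrite scaler_suml.
  by apply: eq_bigr => l _; rewrite scalerA.
rewrite assoc; move: ps; rewrite inE => /orP[/eqP ->|/ra' //].
by rewrite big1 // => l _; rewrite ra mul0r.
Qed.

Section Vanishing.
Variables (V : lmodType R^c) (T : zmodType) (t : V -> F -> T).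
Hypotheses (ht : is_tensor t) (Ff : eqflat F).

(** A vanishing tensor is a sum of syzygies times elements y, but these syzygies may involve further
    elements of V. That the extra coordinates cancel is a linear system on y over R, and flatness
    solves it. *)
Lemma eqflat_vanish (I : finType) (v : I -> V) (x : I -> F) :
  \sum_i t (v i) (x i) = 0 ->
  exists (K : finType) (a : I -> K -> R) (y : K -> F),
    (forall i, x i = \sum_k a i k *: y k) /\
    (forall k, \sum_i (a i k : R^c) *: v i = 0).
Proof.
(* The copies [inl i] carry the given [v i]; the copies [inr w], one for each element of V, make the
   family generating. *)
move=> vx0; pose J : Type := (I + V)%type.
pose c (j : J) : V := match j with inl i => v i | inr w => w end.
have cgen : generating c.
  by move=> w; exists (dinj (inr w : J) (1 : (R^c)^o)); rewrite eps_inj scale1r.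
pose psi : vecs F J := \sum_i dinj (inl i : J) (x i).
have psiR : relations c psi.
  apply: (@tensor_vanish _ _ _ _ _ cgen _ _ ht); rewrite raddf_sum -[RHS]vx0.
  by apply: eq_bigr => i _; rewrite tlift_inj.
have [n [k [y [k0 psiE]]]] := relations_fin psiR.
have coordE j : coord psi j = \sum_a (coord (k a) j : R) *: y a.
  by rewrite psiE coord_sum; apply: eq_bigr => a _; rewrite coord_act.
have psil i : coord psi (inl i) = x i.
  rewrite coord_sum (bigD1 i) // coord_in big1 => [|j /eqP ji]; first by rewrite /= addr0.
  by apply: coord_out; case.
have psir w : coord psi (inr w) = 0.
  by rewrite coord_sum big1 // => i _; apply: coord_out.
have [s [_ sk]] := common_support k.
(* One equation for each extra generator [inr w], and none (coefficient 0) at [inl i]. Outside the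
   common support [s] all the equations are trivial, so a finite system remains. *)
pose r (j : {classic J}) a : R := if j is inr w then coord (k a) (inr w) else 0.
have [|L [b [z [yE bk]]]] := eqflat_system (K := {classic J}) (s := s)
    (r := r) (x := y) Ff.
  move=> [i|w] _ /=; first by rewrite big1 // => a _; rewrite scale0r.
  by rewrite -coordE psir.
have bk' (w : V) l : \sum_a (coord (k a) (inr w) : R) * b a l = 0.
  have [/bk->//|ws] := boolP ((inr w : {classic J}) \in s).
  by rewrite big1 // => a _; rewrite sk // mul0r.
exists L, (fun i l => \sum_a (coord (k a) (inl i) : R) * b a l), z; split=> [i|l].
  rewrite -psil coordE; under eq_bigr do rewrite yE scaler_sumr.
  rewrite exchange_big; apply: eq_bigr => l _; rewrite scaler_suml.
  by apply: eq_bigr => a _; rewrite scalerA.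
(* The combination of the syzygies [k a] by column [l] of [b] is again a syzygy; its [inr]
   coordinates vanish, so it relates the [v i] alone. *)
pose kl : coefs R J := \sum_a (b a l : R^c) *: k a.
have coordk j : coord kl j = \sum_a (coord (k a) j : R) * b a l.
  by rewrite coord_sum; apply: eq_bigr.
have : eps c kl = 0.
  by rewrite linear_sum big1 // => a _; rewrite linearZ_LR k0 scaler0.
suff -> : kl = \sum_i dinj (inl i : J) (coord kl (inl i)).
  rewrite linear_sum => kl0; rewrite -[RHS]kl0; apply: eq_bigr => i _.
  by rewrite eps_inj coordk.
apply: dsum_eq => -[i|w]; rewrite [RHS]coord_sum.
  rewrite (bigD1 i) // coord_in big1 => [|j /eqP ji]; first by rewrite /= addr0.
  by apply: coord_out; case.
by rewrite coordk bk' big1 // => i _; apply: coord_out.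
Qed.
End Vanishing.
End Flatness.

Section FlatClosure.
Variable R : pzRingType.

Lemma tensor_elements (V : lmodType R^c) (F : lmodType R) (T : zmodType)
    (t : V -> F -> T) (z : T) : is_tensor t ->
  exists (I : finType) (v : I -> V) (x : I -> F), z = \sum_i t (v i) (x i).
Proof.
move=> ht.
have cgen : generating (idfun : V -> V).
  by move=> w; exists (dinj w (1 : (R^c)^o)); rewrite eps_inj scale1r.
have [psi ->] := tensor_generated cgen ht z.
have [s us sx] := dsum_support psi.
exists 'I_(size s), (tnth (in_tuple s)), (fun i => coord psi (tnth (in_tuple s) i)).
by rewrite /tlift (dlift_supp _ us sx) big_tnth.
Qed.

Lemma tensor_ext (V : lmodType R^c) (F : lmodType R) (T G : zmodType)
    (t : V -> F -> T) (h h' : {additive T -> G}) : is_tensor t ->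
  (forall v x, h (t v x) = h' (t v x)) -> h =1 h'.
Proof.
move=> ht E z; have [I [v [x ->]]] := tensor_elements z ht.
by rewrite !raddf_sum; apply: eq_bigr.
Qed.

(** If a sum of u_i (x) x_i dies in V (x) F, the resulting matrix kills the [i (u_j)], hence the u_j
    because [i] is injective, and so the tensor was zero already. *)
Lemma eqflat_flat (F : lmodType R) : eqflat F -> flat F.
Proof.
move=> Ff U V i i_inj T t T' t' ht ht' h hE.
suff h0 z : h z = 0 -> z = 0.
  by move=> z z' E; apply/eqP; rewrite -subr_eq0 (h0 (z - z')) // raddfB E subrr.
have [I [u [x ->]]] := tensor_elements z ht.
rewrite raddf_sum; under eq_bigr do rewrite hE.
move=> /(eqflat_vanish ht' Ff)[K [a [y [xE a0]]]].
have [_ _ tZ] := ht.1.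
under eq_bigr do rewrite xE (balanced_sumr ht.1).
rewrite exchange_big big1 // => k _; under eq_bigr do rewrite -tZ.
rewrite -(balanced_suml ht.1) (_ : \sum_i _ = 0) ?(balanced0l ht.1) //.
by apply: i_inj; rewrite linear0 linear_sum -[RHS](a0 k); apply: eq_bigr => j _; rewrite linearZ_LR.
Qed.

Lemma eqflat_retract (E F : lmodType R) (i : {linear E -> F})
    (p : {linear F -> E}) : (forall x, p (i x) = x) -> eqflat F -> eqflat E.
Proof.
move=> ipK Ff I r x rx0.
have [|K [a [y [xE ra]]]] := Ff I r (fun k => i (x k)).
  by rewrite -[RHS](linear0 i) -rx0 linear_sum; apply: eq_bigr => k _; rewrite linearZ_LR.
exists K, a, (fun k => p (y k)); split=> // k.
by rewrite -[LHS]ipK xE linear_sum; apply: eq_bigr => l _; rewrite linearZ_LR.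
Qed.

Lemma eqflat_regular : eqflat (R^o : lmodType R).
Proof.
move=> I r x rx0; exists 'I_1, (fun i _ => x i), (fun=> 1 : R^o); split=> [i|_].
  by rewrite big_ord1 -[RHS]/(x i * 1 : R) mulr1.
exact: rx0.
Qed.

(** Induction on a common support: the relation is solved in the summand [M j] and for the
    remainders [x'], which avoid [j]; the two solutions are placed side by side. *)
Lemma eqflat_dsum (I : Type) (M : I -> lmodType R) :
  (forall i, eqflat (M i)) -> eqflat (dsum M).
Proof.
move=> Mf K r x rx0; have [s [_ sx]] := common_support x.
elim: s x rx0 sx => [|j s IH] x rx0 sx.
  exists 'I_0, (fun _ _ => 0), (fun _ => 0); split=> [k|[m m0]]; last by rewrite ltn0 in m0.
  by rewrite big_ord0; apply: dsum_eq => i; rewrite sx.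
have [|L1 [a1 [y1 [xE1 ra1]]]] := Mf j K r (fun k => coord (x k) j).
  by rewrite -[RHS](coord0 M j) -rx0 coord_sum.
pose x' k := x k - dinj j (coord (x k) j).
have [||L2 [a2 [y2 [xE2 ra2]]]] := IH x'.
- under eq_bigr do rewrite scalerBr; rewrite sumrB rx0 sub0r.
  under eq_bigr do rewrite -linearZ_LR -coordZ; rewrite -linear_sum -coord_sum rx0.
  by rewrite coord0 linear0 oppr0.
- move=> k i nis; rewrite coordD coordN.
  have [<-|ji] := pselect (j = i); first by rewrite coord_in subrr.
  rewrite coord_out // oppr0 addr0; apply: sx; rewrite inE negb_or nis andbT.
  by apply/eqP => ij; apply: ji.
exists (L1 + L2)%type.
exists (fun k l => match l with inl l1 => a1 k l1 | inr l2 => a2 k l2 end).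
exists (fun l => match l with inl l1 => dinj j (y1 l1) | inr l2 => y2 l2 end).
split=> [k|[l|l]//]; rewrite big_sumType /= -xE2.
rewrite -[LHS](addrNK (dinj j (coord (x k) j))) addrC; congr (_ + _).
by rewrite xE1 linear_sum; apply: eq_bigr => l _; rewrite linearZ_LR.
Qed.

Lemma projective_eqflat (P : lmodType R) : projective P -> eqflat P.
Proof.
move=> Pp; pose U := dsum (fun _ : P => R^o : lmodType R).
have lin (x : P) : linear (fun r : R^o => (r : R) *: x).
  by move=> a r r'; rewrite scalerDl scalerA.
pose e : {linear U -> P} := dllift (fun x => mklinear (lin x)).
have [|i iK] := Pp U P e idfun.
  by move=> x; exists (dinj x (1 : R^o)); rewrite dllift_inj /= scale1r.
by apply: (eqflat_retract iK); apply: eqflat_dsum => _; apply: eqflat_regular.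
Qed.
End FlatClosure.

(** * Presentations and coherence *)

(* The family c generates M and its module of relations is generated by the
   finitely many rows of b. *)
Definition presented (A : pzRingType) (M : lmodType A) (K : finType) (c : K -> M) :=
  (forall x, exists r : K -> A, x = \sum_k r k *: c k) /\
  exists (L : finType) (b : L -> K -> A),
    (forall l, \sum_k b l k *: c k = 0) /\
    (forall r : K -> A, \sum_k r k *: c k = 0 ->
      exists s : L -> A, forall k, r k = \sum_l s l * b l k).

Section Presentations.
Variable A : pzRingType.

Lemma fg_generators (M : lmodType A) : finitely_generated M ->
  exists (K : finType) (c : K -> M), forall x, exists r : K -> A, x = \sum_k r k *: c k.
Proof.
move=> [n [g gS]]; exists 'I_n, (fun k => g (delta_mx 0 k)) => x.
have [u <-] := gS x; exists (fun k => u 0 k).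
by rewrite {1}(row_sum_delta u) linear_sum; apply: eq_bigr => k _; rewrite linearZ_LR.
Qed.

Lemma rV_projective n : projective 'rV[A]_n.
Proof.
move=> U V p f pS.
have /choice[w wE] : forall k, exists x, p x = f (delta_mx 0 k) by move=> k; apply: pS.
have lin : linear (fun u : 'rV[A]_n => \sum_k u 0 k *: w k).
  move=> a u v; rewrite scaler_sumr -big_split; apply: eq_bigr => k _.
  by rewrite !mxE scalerDl scalerA.
exists (mklinear lin) => u /=.
rewrite [in RHS](row_sum_delta u) !linear_sum.
by apply: eq_bigr => k _; rewrite !linearZ_LR wE.
Qed.

(** Schanuel's argument: finite generation of the relations for one projective cover passes to any
    finite generating family. The map [sg] lifts [g] to A^K, and [ta] goes back from A^K to V over
    M. *)
Lemma presented_of_exact (U V M : lmodType A) (f : {linear U -> V})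
    (g : {linear V -> M}) (K : finType) (c : K -> M) :
    exact f g -> surjective g -> projective V -> finitely_generated U ->
    (forall x, exists r : K -> A, x = \sum_k r k *: c k) ->
  presented c.
Proof.
move=> fg gS Vp /fg_generators[L [u uS]] cS; split=> //.
pose FK : lmodType A := prodm (fun _ : K => A^o : lmodType A).
have linp : linear (fun r : FK => \sum_k (r k : A) *: c k).
  move=> a r s; rewrite scaler_sumr -big_split; apply: eq_bigr => k _.
  by rewrite -[(a *: r + s) k]/(a * r k + s k) scalerDl scalerA.
have [|sg sgE] := Vp FK M (mklinear linp) g.
  by move=> x; have [r ->] := cS x; exists r.
have /choice[w wE] : forall k, exists x, g x = c k by move=> k; apply: gS.
pose ta (r : FK) : V := \sum_k (r k : A) *: w k.
pose e k : FK := fun j => (j == k)%:R.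
have FKE (r : FK) : r = \sum_k (r k : A) *: e k.
  apply: functional_extensionality_dep => j; rewrite prodm_sum (bigD1 j) //= big1.
    by rewrite addr0 -[RHS]/(r j * (j == j)%:R) eqxx mulr1.
  by move=> k; rewrite eq_sym => /negPf kj; rewrite -[LHS]/(r k * (j == k)%:R) kj mulr0.
(* There are two kinds of relations: the images under [sg] of generators of the kernel of [g], and
   the defects e_k - sg(w_k) of the round trip through V. *)
exists (L + K)%type.
exists (fun l => match l with inl l => sg (f (u l)) | inr k => e k - sg (w k) end).
split=> [[l|k]|r r0].
- by transitivity (g (f (u l))); [exact: sgE | apply/fg; exists (u l)].
- rewrite -[LHS]/(mklinear linp (e k - sg (w k))) linearB sgE wE.
  rewrite -[mklinear _ _]/(\sum_j (j == k)%:R *: c j) (bigD1 k) //= eqxx scale1r.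
  by rewrite big1 ?addr0 ?subrr // => j /negPf ->; rewrite scale0r.
have : g (ta r) = 0.
  by rewrite linear_sum -[RHS]r0; apply: eq_bigr => k _; rewrite linearZ_LR wE.
move=> /fg[x xr]; have [s sE] := uS x.
exists (fun l => match l with inl l => s l | inr k => r k end) => k.
(* This is r = sg (ta r) + (r - sg (ta r)); the first term comes from the kernel of [g] because [r]
   is a relation. *)
have E : (r : FK) = \sum_l s l *: sg (f (u l)) + \sum_j (r j : A) *: (e j - sg (w j)).
  have -> : \sum_l s l *: sg (f (u l)) = sg (ta r).
    by rewrite -xr sE !linear_sum; apply: eq_bigr => l _; rewrite !linearZ_LR.
  under eq_bigr do rewrite scalerBr; rewrite sumrB -FKE /ta linear_sum.
  by under eq_bigr do rewrite linearZ_LR; rewrite addrC subrK.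
rewrite big_sumType /=; rewrite {1}E.
rewrite -[LHS]/((\sum_l s l *: sg (f (u l))) k + (\sum_j (r j : A) *: (e j - sg (w j))) k).
by rewrite !prodm_sum.
Qed.

Lemma presented_of_fp (M : lmodType A) (K : finType) (c : K -> M) :
    finitely_presented M ->
    (forall x, exists r : K -> A, x = \sum_k r k *: c k) ->
  presented c.
Proof.
move=> [m [n [f [g [fg gS]]]]]; apply: (presented_of_exact fg gS).
  exact: rV_projective.
by exists m, idfun => u; exists u.
Qed.

Lemma resolution_presented (M : lmodType A) (P : projective_resolution M) :
  degreewise_finite P -> exists (K : finType) (c : K -> M), presented c.
Proof.
move=> Pf; have [K [d dS]] := fg_generators (Pf 0%N).
exists K, (fun k => res_aug P (d k)).
apply: (presented_of_exact (f := res_diff P 0) (g := res_aug P)).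
- exact: res_exact0.
- exact: res_aug_surj.
- exact: res_projective.
- exact: (Pf 1%N).
move=> x; have [y <-] := res_aug_surj P x; have [r ->] := dS y; exists r.
by rewrite linear_sum; apply: eq_bigr => k _; rewrite linearZ_LR.
Qed.
End Presentations.

(** By coherence the syzygies of [r] are generated by finitely many rows [b]. The same matrix [b]
    then serves every factor, and only the vectors [y] depend on [i]. *)
Lemma eqflat_prod (R : pzRingType) (I : Type) (F : I -> lmodType R) :
  right_coherent R -> (forall i, eqflat (F i)) -> eqflat (prodm F).
Proof.
move=> Rc Ff K r x rx0.
pose J : lmodType R^c := submod_of (right_ideal r).
pose c k : J := exist _ _ (right_ideal_gen r k).
have sumc (a : K -> R) : sval (\sum_k (a k : R^c) *: c k) = \sum_k r k * a k.
  by rewrite submod_of_sum.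
have cS (u : J) : exists a : K -> R^c, u = \sum_k a k *: c k.
  by case: (u) => s [a sa]; exists a; apply: submod_of_eq; rewrite sumc.
have Jfg : finitely_generated J.
  have lin : linear (fun u : 'rV[R^c]_#|K| => \sum_i u 0 i *: c (enum_val i)).
    move=> a u v; rewrite scaler_sumr -big_split; apply: eq_bigr => k _.
    by rewrite !mxE scalerDl scalerA.
  exists #|K|, (mklinear lin) => u; have [a ->] := cS u.
  exists (\row_i a (enum_val i)) => /=; rewrite [RHS](reindex _ (onW_bij _ (enum_val_bij K))).
  by apply: eq_bigr => i _; rewrite mxE.
have := Rc J (submod_val _) (@submod_val_inj _ _ _) Jfg.
move=> /presented_of_fp /(_ cS)[_ [L [b [b0 bS]]]].
have rb l : \sum_k r k * (b l k : R) = 0 by rewrite -sumc b0.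
have /dep_choice[y yE] : forall i, exists y : L -> F i, forall k, x k i = \sum_l (b l k : R) *: y l.
  move=> i; have [|K' [a [z [xE ra]]]] := Ff i K r (fun k => x k i).
    by rewrite -[RHS]/((0 : prodm F) i) -rx0 prodm_sum.
  (* Each column of [a] is a relation among the [r k], hence a combination of the rows of [b]. *)
  have /choice[s sE] : forall k', exists s : L -> R, forall k, a k k' = \sum_l (b l k : R) * s l.
    by move=> k'; apply: bS; apply: submod_of_eq; rewrite sumc ra.
  exists (fun l => \sum_k' s k' l *: z k') => k.
  rewrite xE; under [RHS]eq_bigr do rewrite scaler_sumr.
  rewrite exchange_big; apply: eq_bigr => k' _; rewrite sE scaler_suml.
  by apply: eq_bigr => l _; rewrite scalerA.
exists L, (fun k l => b l k : R), (fun l => (fun i => y i l) : prodm F); split=> // k.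
by apply: functional_extensionality_dep => i; rewrite yE prodm_sum.
Qed.

(** * The module Hom_S(C, L) *)

Section HomModule.
Variables (S R : pzRingType) (C : bimodule S R) (L : lmodType S).

Definition homC : Type := {linear bimod_left C -> L}.

HB.instance Definition _ := gen_eqMixin homC.
HB.instance Definition _ := gen_choiceMixin homC.

Definition hc_fun (phi : homC) : bimod_left C -> L := phi : {linear bimod_left C -> L}.

Fact hc_zero_lin : linear (fun _ : bimod_left C => 0 : L).
Proof. by move=> a x y; rewrite scaler0 addr0. Qed.
Fact hc_add_lin (f g : homC) : linear (fun c => hc_fun f c + hc_fun g c).
Proof. by move=> a x y; rewrite /hc_fun !linearP scalerDr addrACA. Qed.
Fact hc_opp_lin (f : homC) : linear (fun c => - hc_fun f c).
Proof. by move=> a x y; rewrite /hc_fun linearP opprD scalerN. Qed.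
Fact hc_scale_lin (r : R) (f : homC) : linear (fun c => hc_fun f (bimod_act c r)).
Proof. by move=> a x y; rewrite /hc_fun bimod_actDl bimod_actZ linearP. Qed.

Definition hc_zero : homC := mklinear hc_zero_lin.
Definition hc_add f g : homC := mklinear (hc_add_lin f g).
Definition hc_opp f : homC := mklinear (hc_opp_lin f).
Definition hc_scale r f : homC := mklinear (hc_scale_lin r f).

Fact hc_addA : associative hc_add.
Proof. by move=> f g h; apply: linear_ext => c; apply: addrA. Qed.
Fact hc_addC : commutative hc_add.
Proof. by move=> f g; apply: linear_ext => c; apply: addrC. Qed.
Fact hc_add0 : left_id hc_zero hc_add.
Proof. by move=> f; apply: linear_ext => c; apply: add0r. Qed.
Fact hc_addN : left_inverse hc_zero hc_opp hc_add.
Proof. by move=> f; apply: linear_ext => c; apply: addNr. Qed.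
HB.instance Definition _ := GRing.isZmodule.Build homC hc_addA hc_addC hc_add0 hc_addN.

Fact hc_scaleA a b f : hc_scale a (hc_scale b f) = hc_scale (a * b) f.
Proof. by apply: linear_ext => c; rewrite /= bimod_actM. Qed.
Fact hc_scale1 : left_id 1 hc_scale.
Proof. by move=> f; apply: linear_ext => c; rewrite /= bimod_act1. Qed.
Fact hc_scaleDr : right_distributive hc_scale +%R.
Proof. by move=> r f g; apply: linear_ext. Qed.
Fact hc_scaleDl f : {morph hc_scale^~ f : a b / a + b}.
Proof. by move=> a b; apply: linear_ext => c; rewrite /= /hc_fun bimod_actDr linearD. Qed.
HB.instance Definition _ := GRing.Zmodule_isLmodule.Build R homC
  hc_scaleA hc_scale1 hc_scaleDr hc_scaleDl.

Lemma homC_ext (f g : homC) : (forall c, hc_fun f c = hc_fun g c) -> f = g.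
Proof. exact: linear_ext. Qed.
Lemma homCD (f g : homC) c : hc_fun (f + g) c = hc_fun f c + hc_fun g c.
Proof. by []. Qed.
Lemma homCZ r (f : homC) c : hc_fun (r *: f) c = hc_fun f (bimod_act c r).
Proof. by []. Qed.
Lemma homC0 c : hc_fun 0 c = 0.
Proof. by []. Qed.
Lemma homC_sum (I : Type) (s : seq I) (f : I -> homC) c :
  hc_fun (\sum_(i <- s) f i) c = \sum_(i <- s) hc_fun (f i) c.
Proof. by elim/big_rec2: _ => // i y z _ <-. Qed.
End HomModule.

(** * Coinduced modules and S-linear tensor products *)

Section Coinduction.
Variables (S : pzRingType) (G : zmodType).

Definition coind : Type := {f : S -> G | {morph f : x y / x + y}}.

HB.instance Definition _ := gen_eqMixin coind.
HB.instance Definition _ := gen_choiceMixin coind.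

Lemma coind_ext (f g : coind) : (forall s, sval f s = sval g s) -> f = g.
Proof. by case: f g => [f fD] [g gD] /= /funext E; apply: eq_exist. Qed.

Fact ci_zeroD : {morph (fun _ : S => 0 : G) : x y / x + y}.
Proof. by move=> x y; rewrite addr0. Qed.
Fact ci_addD (f g : coind) : {morph (fun s => sval f s + sval g s) : x y / x + y}.
Proof. by move=> x y; rewrite (svalP f) (svalP g) addrACA. Qed.
Fact ci_oppD (f : coind) : {morph (fun s => - sval f s) : x y / x + y}.
Proof. by move=> x y; rewrite (svalP f) opprD. Qed.
Fact ci_scaleD (a : S) (f : coind) : {morph (fun s => sval f (s * a)) : x y / x + y}.
Proof. by move=> x y; rewrite mulrDl (svalP f). Qed.

Definition ci_zero : coind := exist _ (fun=> 0) ci_zeroD.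
Definition ci_add (f g : coind) : coind := exist _ (fun s => sval f s + sval g s) (ci_addD f g).
Definition ci_opp (f : coind) : coind := exist _ (fun s => - sval f s) (ci_oppD f).
Definition ci_scale (a : S) (f : coind) : coind := exist _ (fun s => sval f (s * a)) (ci_scaleD a f).

Fact ci_addA : associative ci_add.
Proof. by move=> f g h; apply: coind_ext => s; apply: addrA. Qed.
Fact ci_addC : commutative ci_add.
Proof. by move=> f g; apply: coind_ext => s; apply: addrC. Qed.
Fact ci_add0 : left_id ci_zero ci_add.
Proof. by move=> f; apply: coind_ext => s; apply: add0r. Qed.
Fact ci_addN : left_inverse ci_zero ci_opp ci_add.
Proof. by move=> f; apply: coind_ext => s; apply: addNr. Qed.
HB.instance Definition _ := GRing.isZmodule.Build coind ci_addA ci_addC ci_add0 ci_addN.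

Fact ci_scaleA a b f : ci_scale a (ci_scale b f) = ci_scale (a * b) f.
Proof. by apply: coind_ext => s; rewrite /= mulrA. Qed.
Fact ci_scale1 : left_id 1 ci_scale.
Proof. by move=> f; apply: coind_ext => s; rewrite /= mulr1. Qed.
Fact ci_scaleDr : right_distributive ci_scale +%R.
Proof. by move=> r f g; apply: coind_ext. Qed.
Fact ci_scaleDl f : {morph ci_scale^~ f : a b / a + b}.
Proof. by move=> a b; apply: coind_ext => s; rewrite /= mulrDr (svalP f). Qed.
HB.instance Definition _ := GRing.Zmodule_isLmodule.Build S coind
  ci_scaleA ci_scale1 ci_scaleDr ci_scaleDl.
End Coinduction.

Section Bitensor.
Variables (S R : pzRingType) (C : bimodule S R) (F : lmodType R).

Definition slinear (N : lmodType S) (g : bimod_right C -> F -> N) :=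
  forall (s : S) (c : C) (x : F), g (s *: c) x = s *: g c x.

Variables (M : lmodType S) (t : bimod_right C -> F -> M).

(* An additive group G is tested through the coinduced S-module Hom_Z(S, G). *)
Lemma tensor_of_slinear : balanced t -> slinear t ->
    (forall (N : lmodType S) (g : bimod_right C -> F -> N), balanced g -> slinear g ->
      exists h : {linear M -> N}, (forall c x, h (t c x) = g c x) /\
        (forall h' : {linear M -> N}, (forall c x, h' (t c x) = g c x) -> h' =1 h)) ->
  is_tensor t.
Proof.
move=> bt st univ; split=> // G g [gDl gDr gZ].
have gcD (c : C) x : {morph (fun s : S => g (s *: c) x) : a b / a + b}.
  by move=> a b; rewrite scalerDl; apply: gDl.
pose gc (c : bimod_right C) x : coind S G := exist _ (fun s : S => g (s *: (c : C)) x) (gcD c x).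
have [||h [hE hU]] := univ _ gc.
- split=> [u u' x|u x x'|u r x]; apply: coind_ext => s /=.
  + rewrite -gDl; congr g; exact: (scalerDr s (u : C) (u' : C)).
  + exact: gDr.
  + rewrite -gZ; congr g; exact: (esym (bimod_actZ s (u : C) r)).
- by move=> s c x; apply: coind_ext => a /=; rewrite scalerA.
(* Evaluation at 1 turns a map into the coinduced module back into a map into [G]. *)
have hD : {morph (fun z => sval (h z) 1) : x y / x + y} by move=> x y; rewrite linearD.
exists (mkadditive hD); split=> [c x|h' h'E z] /=.
  by rewrite hE /=; congr g; exact: (scale1r (c : C)).
have h'D z' : {morph (fun s : S => h' (s *: z')) : a b / a + b}.
  by move=> a b; rewrite scalerDl raddfD.
(* Conversely, any additive [h'] is the evaluation at 1 of this S-linear map, so uniqueness is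
   inherited from S-linear maps. *)
pose hc z' : coind S G := exist _ (fun s : S => h' (s *: z')) (h'D z').
have hclin : linear hc.
  move=> a x y; apply: coind_ext => s /=.
  by rewrite scalerDr raddfD scalerA.
have := hU (mklinear hclin); rewrite /= => <-; first by rewrite /= scale1r.
by move=> c x; apply: coind_ext => s /=; rewrite -st h'E.
Qed.

Lemma tensor_slinear : is_tensor t -> slinear t ->
  forall (N : lmodType S) (g : bimod_right C -> F -> N), balanced g -> slinear g ->
  exists2 h : {linear M -> N}, (forall c x, h (t c x) = g c x) &
    (forall h' : {linear M -> N}, (forall c x, h' (t c x) = g c x) -> h' =1 h).
Proof.
move=> tt st N g bg sg; have [h [hE hU]] := tt.2 _ _ bg.
have hlin : linear h.
  move=> a x y; rewrite raddfD; congr (_ + _); move: x.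
  have e1 : {morph (fun x => h (a *: x)) : x y / x + y}.
    by move=> x y'; rewrite scalerDr raddfD.
  have e2 : {morph (fun x => a *: h x) : x y / x + y}.
    by move=> x y'; rewrite raddfD scalerDr.
  apply: (tensor_ext (h := mkadditive e1) (h' := mkadditive e2) tt) => c x /=.
  by rewrite -st !hE sg.
exists (mklinear hlin) => [//|h' h'E]; exact: (hU h').
Qed.
End Bitensor.

Lemma presented_lift (A : pzRingType) (M N : lmodType A) (K : finType)
    (c : K -> M) (w : K -> N) :
    (forall x, exists r : K -> A, x = \sum_k r k *: c k) ->
    (forall r : K -> A, \sum_k r k *: c k = 0 -> \sum_k r k *: w k = 0) ->
  exists f : {linear M -> N}, forall k, f (c k) = w k.
Proof.
move=> /choice[r rE] cw.
have wE (s : K -> A) : \sum_k r (\sum_k s k *: c k) k *: w k = \sum_k s k *: w k.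
  apply/eqP; rewrite -subr_eq0 -sumrB; apply/eqP; under eq_bigr do rewrite -scalerBl.
  apply: cw; under eq_bigr do rewrite scalerBl.
  by rewrite sumrB -rE subrr.
have lin : linear (fun x => \sum_k r x k *: w k).
  move=> a x y; rewrite scaler_sumr -big_split /=.
  under [RHS]eq_bigr do rewrite scalerA -scalerDl.
  have -> : a *: x + y = \sum_k (a * r x k + r y k) *: c k.
    rewrite {1}(rE x) {1}(rE y) scaler_sumr -big_split.
    by apply: eq_bigr => k _; rewrite scalerA scalerDl.
  exact: wE.
exists (mklinear lin) => k /=.
have E : c k = \sum_j (j == k)%:R *: c j.
  by rewrite (bigD1 k) //= eqxx scale1r big1 ?addr0 // => j /negPf ->; rewrite scale0r.
rewrite {1}E wE (bigD1 k) //= eqxx scale1r big1 ?addr0 // => j /negPf ->.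
by rewrite scale0r.
Qed.

Lemma generators_ext (A : pzRingType) (M N : lmodType A) (K : finType) (c : K -> M)
    (f g : {linear M -> N}) :
    (forall x, exists r : K -> A, x = \sum_k r k *: c k) ->
  (forall k, f (c k) = g (c k)) -> f =1 g.
Proof.
move=> cS E x; have [r ->] := cS x; rewrite !linear_sum.
by apply: eq_bigr => k _; rewrite !linearZ_LR E.
Qed.

(** The induction of [eqflat_system] again, with relations between tensors in place of relations
    over R and [eqflat_vanish] killing them one at a time. *)
Lemma eqflat_vanish_system (R : pzRingType) (F : lmodType R) (V : lmodType R^c)
    (T : zmodType) (t : V -> F -> T) (N : eqType) (s : seq N) (I : finType)
    (v : N -> I -> V) (x : I -> F) : is_tensor t -> eqflat F ->
    (forall n, n \in s -> \sum_i t (v n i) (x i) = 0) ->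
  exists (K : finType) (a : I -> K -> R) (y : K -> F),
    (forall i, x i = \sum_k a i k *: y k) /\
    (forall n, n \in s -> forall k, \sum_i (a i k : R^c) *: v n i = 0).
Proof.
move=> ht Ff; elim: s I v x => [|n s IH] I v x vx.
  exists I, (fun i j => (i == j)%:R), x; split=> // i.
  rewrite (bigD1 i) //= eqxx scale1r big1 ?addr0 // => j.
  by rewrite eq_sym => /negPf ->; rewrite scale0r.
have [L [a [y [xE va]]]] := eqflat_vanish ht Ff (vx n (mem_head n s)).
have [_ _ tZ] := ht.1.
have [|L' [a' [y' [yE va']]]] := IH L (fun p l => \sum_i (a i l : R^c) *: v p i) y.
  move=> p ps; rewrite -[RHS](vx p) ?inE ?ps ?orbT //.
  under eq_bigr do rewrite (balanced_suml ht.1).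
  rewrite exchange_big; apply: eq_bigr => i _; rewrite xE (balanced_sumr ht.1).
  by apply: eq_bigr => l _; rewrite tZ.
have assoc (w : I -> V) l' : \sum_i ((\sum_l a i l * a' l l' : R) : R^c) *: w i =
    \sum_l (a' l l' : R^c) *: (\sum_i (a i l : R^c) *: w i).
  under [RHS]eq_bigr do rewrite scaler_sumr.
  rewrite exchange_big; apply: eq_bigr => i _; rewrite scaler_suml.
  by apply: eq_bigr => l _; rewrite scalerA.
exists L', (fun i l' => \sum_l a i l * a' l l'), y'; split=> [i|p ps l'].
  rewrite xE; under eq_bigr do rewrite yE scaler_sumr.
  rewrite exchange_big; apply: eq_bigr => l' _; rewrite scaler_suml.
  by apply: eq_bigr => l _; rewrite scalerA.
rewrite assoc; move: ps; rewrite inE => /orP[/eqP ->|/va' //].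
by rewrite big1 // => l _; rewrite va scaler0.
Qed.

(** What matters is that the vectors [v] are shared by all the tensors [z k]: relations among the
    [z k] then become one system in the unknowns [x k j]. *)
Lemma tensor_family (R : pzRingType) (F : lmodType R) (V : lmodType R^c)
    (T : zmodType) (t : V -> F -> T) (K : finType) (z : K -> T) : is_tensor t ->
  exists (J : finType) (v : J -> V) (x : K -> J -> F),
    forall k, z k = \sum_j t (v j) (x k j).
Proof.
move=> ht.
have cgen : generating (idfun : V -> V).
  by move=> w; exists (dinj w (1 : (R^c)^o)); rewrite eps_inj scale1r.
have /choice[psi zE] : forall k, exists psi, z k = tlift idfun ht.1 psi.
  by move=> k; apply: tensor_generated.
have [s [us sx]] := common_support psi.
exists 'I_(size s), (tnth (in_tuple s)), (fun k i => coord (psi k) (tnth (in_tuple s) i)).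
move=> k; have sk : supported s (sval (psi k)) by exact: (sx k).
by rewrite zE /tlift (dlift_supp _ us sk) big_tnth.
Qed.

(** * The isomorphism from F to Hom_S(C, C (x) F) for flat F *)

Section Semidualizing.
Variables (S R : pzRingType) (C : bimodule S R).
Hypothesis hC : semidualizing C.

Lemma left_presented : exists (K : finType) (d : K -> C), presented d.
Proof. by have [P Pf] := sd_left_finite hC; apply: resolution_presented Pf. Qed.

Lemma right_presented : exists (K : finType) (c : K -> bimod_right C), presented c.
Proof. by have [P Pf] := sd_right_finite hC; apply: resolution_presented Pf. Qed.

Lemma right_faithful (r : R) : (forall c : C, bimod_act c r = 0) -> r = 0.
Proof.
move=> r0; have [r' [_ U]] := sd_right_homothety hC (@hc_zero S R C C).
rewrite -(U r) => [|c]; last by rewrite r0.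
apply: U => c; apply: (addrI (bimod_act c 0)).
by rewrite -bimod_actDr !addr0.
Qed.

Section TensorHom.
Variables (F : lmodType R) (M : lmodType S) (t : bimod_right C -> F -> M).
Hypotheses (Ff : eqflat F) (tt : is_tensor t) (st : slinear t).

Definition tensor_at (x : F) : homC C M.
Proof.
refine (mklinear (f := fun c : C => t c x) _).
by move=> a u v; case: tt => -[tDl _ _] _; rewrite -st -tDl.
Defined.

(** The equations d_k (x) x = 0 for the finitely many generators of C give x as a sum of a_l y_l
    with all d_k a_l = 0. Each a_l then annihilates C, so it is 0. *)
Lemma tensor_at_inj x : (forall c : C, t c x = 0) -> x = 0.
Proof.
move=> x0; have [K [d [dS _]]] := left_presented.
have [|L [a [y [xE da]]]] := eqflat_vanish_system (s := enum K) (I := 'I_1)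
    (v := fun k _ => d k : bimod_right C) (x := fun=> x) tt Ff.
  by move=> k _; rewrite big_ord1 x0.
rewrite (xE 0) big1 // => l _.
suff -> : a 0 l = 0 by rewrite scale0r.
apply: right_faithful => c; have [r ->] := dS c.
have actD0 : {morph (fun c : C => bimod_act c (a 0 l)) : x y / x + y}.
  by move=> u v; apply: bimod_actDl.
rewrite -[LHS]/(mkadditive actD0 (\sum_k r k *: d k)) raddf_sum big1 // => k _ /=.
rewrite bimod_actZ; have := da k (mem_enum _ k) l; rewrite big_ord1.
by rewrite -[_ *: _]/(bimod_act (d k) (a 0 l)) => ->; rewrite scaler0.
Qed.

(* This is F = Hom_S(C, C) (x) F -> Hom_S(C, C (x) F). The values of phi on the
   generators d of C satisfy the relations b; by flatness they can be written
   w_q (x) y_q with each w_q satisfying the same relations, so that w_q is the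
   image of d under an endomorphism of C, i.e. under some rho_q in R. *)
Lemma tensor_at_surj (phi : homC C M) : exists x, forall c : C, hc_fun phi c = t c x.
Proof.
have [K [d [dS [L [b [b0 bS]]]]]] := left_presented.
have [J [v [x zE]]] := tensor_family (fun k => hc_fun phi (d k)) tt.
(* For each relation [l] among the generators, the sum over pairs (k, j) of b_lk v_j (x) x_kj is
   [phi] of 0. The unknowns are indexed by pairs so that all these relations form one system. *)
have [|Q [a [y [xE va]]]] := eqflat_vanish_system (s := enum L) (I := (K * J)%type)
    (v := fun l p => (b l p.1 *: (v p.2 : C) : bimod_right C)) (x := fun p => x p.1 p.2) tt Ff.
  move=> l _; rewrite -(pair_bigA _ (fun k j => t (b l k *: (v j : C)) (x k j))) /=.
  transitivity (hc_fun phi (\sum_k b l k *: d k)); last by rewrite b0 /hc_fun linear0.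
  rewrite /hc_fun linear_sum; apply: eq_bigr => k _; rewrite linearZ_LR.
  by rewrite -[phi (d k)]/(hc_fun phi (d k)) zE scaler_sumr; apply: eq_bigr => j _; rewrite st.
pose w q k : C := \sum_j bimod_act (v j : C) (a (k, j) q).
have /choice[rho rhoE] : forall q, exists r : R, forall k, w q k = bimod_act (d k) r.
  move=> q; have [|f fE] := presented_lift (N := C) (w := w q) dS.
    move=> r /bS[s sE]; under eq_bigr do rewrite sE scaler_suml.
    rewrite exchange_big big1 // => l _.
    under eq_bigr do rewrite -scalerA; rewrite -scaler_sumr.
    rewrite (_ : \sum_k _ = 0) ?scaler0 //.
    rewrite -[RHS](va l (mem_enum _ l) q).
    pose g k j := (a (k, j) q : R^c) *: (b l k *: (v j : C) : bimod_right C).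
    rewrite [RHS](eq_bigr (fun p => g p.1 p.2)) => [|[]//].
    rewrite -(pair_bigA _ g) /=.
    apply: eq_bigr => k _; rewrite scaler_sumr; apply: eq_bigr => j _.
    by rewrite -bimod_actZ.
  have [r [rE _]] := sd_right_homothety hC f.
  by exists r => k; rewrite -fE rE.
exists (\sum_q rho q *: y q) => c; move: c.
apply: (generators_ext (f := phi : {linear bimod_left C -> M}) (g := tensor_at _) dS) => k.
rewrite -[LHS]/(hc_fun phi (d k)) zE -[RHS]/(t (d k) _) (balanced_sumr tt.1).
have [_ _ tZ] := tt.1.
under [RHS]eq_bigr do rewrite -tZ.
transitivity (\sum_q t (w q k) (y q)); last by apply: eq_bigr => q _; rewrite rhoE.
under [RHS]eq_bigr do rewrite (balanced_suml tt.1 _ (fun j => bimod_act (v j : C) (a (_, j) _))).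
rewrite exchange_big; apply: eq_bigr => j _.
have -> : x k j = \sum_q a (k, j) q *: y q by exact: (xE (k, j)).
rewrite (balanced_sumr tt.1).
by apply: eq_bigr => q _; rewrite -tZ.
Qed.

Lemma tensor_at_uniq x y : (forall c : C, t c x = t c y) -> x = y.
Proof.
have [_ tDr _] := tt.1.
move=> E; apply/eqP; rewrite -subr_eq0; apply/eqP/tensor_at_inj => c.
by rewrite -[LHS]/(mkadditive (balanced_morph tt.1 c) (x - y)) raddfB /= E subrr.
Qed.
End TensorHom.

(** * The classes F_C and P_C *)

(** Common form of F_C and P_C, with [X] taken to be [eqflat] or [projective]. *)
Definition tensor_class (X : lmodType R -> Prop) (M : lmodType S) :=
  exists2 F, X F & is_left_tensor C F M.

Section TensorClass.
Variable X : lmodType R -> Prop.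

(* The module witnessing K in the class is Hom_S(C, K), a retract of
   Hom_S(C, C (x) F) = F. *)
Lemma tensor_class_summands :
    (forall F, X F -> eqflat F) ->
    (forall (E F : lmodType R) (i : {linear E -> F}) (p : {linear F -> E}),
      (forall x, p (i x) = x) -> X F -> X E) ->
  closed_under_direct_summands (tensor_class X).
Proof.
move=> Xf Xr K M [F XF [t [tt st]]] [K' [f fbij]].
have [f' fK f'K] := fbij.
have f'lin : linear f' by exact: can2_linear fK f'K.
have ilin : linear (fun x : K => f (x, 0)).
  move=> a x y; rewrite -linearP; congr (f _).
  by rewrite -[RHS]/(a *: x + y, a *: 0 + 0) scaler0 addr0.
have plin : linear (fun z => (f' z).1) by move=> a x y; rewrite f'lin.
pose i : {linear K -> M} := mklinear ilin.
pose p : {linear M -> K} := mklinear plin.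
have pi x : p (i x) = x by rewrite /= fK.
have Ff := Xf F XF; have [[tDl tDr tZ] _] := tt.
have ext := tensor_at_uniq Ff tt.
(* [io] is composition with [i] followed by the inverse of F -> Hom_S(C, M); [po] below is F ->
   Hom_S(C, M) followed by composition with [p]. They make Hom_S(C, K) a retract of F. *)
have /choice[io ioE] : forall phi : homC C K, exists x, forall c : C, i (hc_fun phi c) = t c x.
  move=> phi; have lin : linear (fun c : C => i (hc_fun phi c)).
    by move=> a u v; rewrite /hc_fun !linearP.
  exact: (tensor_at_surj Ff tt st (mklinear lin)).
have iolin : linear io.
  move=> a u v; apply: ext => c; rewrite -ioE tDr -(tZ c a) homCD homCZ linearD !ioE.
  by [].
have poelin x : linear (fun c : C => p (t c x)).
  by move=> a u v; rewrite -linearP -st -tDl.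
pose po x : homC C K := mklinear (poelin x).
have polin : linear po.
  move=> a x y; apply: homC_ext => c; rewrite homCD homCZ /hc_fun /= tDr.
  by rewrite -(tZ c a x) -[LHS]/(p _) linearD.
exists (homC C K).
  apply: (Xr _ F (mklinear iolin) (mklinear polin)) => // phi.
  by apply: homC_ext => c; rewrite /hc_fun -[LHS]/(p (t c (io phi))) -ioE pi.
exists (fun c phi => hc_fun phi c); split=> [|s c phi]; last by rewrite /hc_fun linearZ_LR.
have evb : balanced (fun (c : bimod_right C) (phi : homC C K) => hc_fun phi c).
  by split=> // u u' phi; rewrite /hc_fun; exact: (linearD (phi : {linear C -> K})).
split=> // G g [gDl gDr gZ].
(* A balanced map on C and Hom_S(C, K) is pulled back along [po], extended to M by the universal
   property there, and restricted along [i]. *)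
have gb : balanced (fun c x => g c (po x)).
  have poD := linearD (mklinear polin); have poZ := linearZ_LR (mklinear polin).
  split=> [u u' x|u x x'|u r x]; first exact: gDl.
    by rewrite -gDr; congr g; exact: poD.
  by rewrite gZ; congr g; exact: (esym (poZ r x)).
have [h [hE _]] := tt.2 _ _ gb.
have hD : {morph (fun z => h (i z)) : x y / x + y} by move=> x y; rewrite linearD raddfD.
exists (mkadditive hD); split=> [c phi|h' h'E z] /=.
  rewrite -[f _]/(i (hc_fun phi c)) ioE hE; congr g.
  by apply: homC_ext => c'; rewrite /hc_fun -[LHS]/(p (t c' (io phi))) -ioE pi.
(* Uniqueness: [h' \o p] and [h] agree on the tensors [t c x], hence on all of M and in particular
   on the image of [i]. *)
rewrite -[f _]/(i z) -{1}(pi z); move: (i z) => {}z.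
have h'pD : {morph (fun z => h' (p z)) : x y / x + y} by move=> x y; rewrite linearD raddfD.
apply: (tensor_ext (h := mkadditive h'pD) tt) => c x /=.
by rewrite -[(f' _).1]/(hc_fun (po x) c) h'E hE.
Qed.

(** The coproduct [L] is known only through maps into S-modules, so the tensor property is checked
    on S-linear balanced maps, as [tensor_of_slinear] allows. *)
Lemma tensor_class_coproducts :
    (forall (I : Type) (F : I -> lmodType R), (forall i, X (F i)) -> X (dsum F)) ->
  closed_under_coproducts (tensor_class X).
Proof.
move=> Xd I M L g XM Lcop.
have /dep_choice[F FE] : forall i, exists F, X F /\ is_left_tensor C F (M i).
  by move=> i; case: (XM i) => F; exists F.
have {FE}[XF FE] : (forall i, X (F i)) /\ forall i, is_left_tensor C (F i) (M i).
  by split=> i; case: (FE i).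
have [t tE] := dep_choice FE.
have tt i : is_tensor (t i) by case: (tE i).
have st i : slinear (t i) by case: (tE i).
have tDr i (c : C) : {morph (fun x : F i => g i (t i c x)) : x y / x + y}.
  by move=> x y; case: (tt i) => -[_ -> _] _; rewrite linearD.
pose T (c : bimod_right C) (x : dsum F) := dlift (fun i => mkadditive (tDr i c)) x.
have TE c i x : T c (dinj i x) = g i (t i c x) by exact: dlift_inj.
exists (dsum F); first exact: Xd.
have Tb : balanced T.
  split=> [u u' x|u x x'|u r x]; last 2 first.
  - exact: raddfD.
  - move: x; apply: (dsum_ext' (h := T ((r : R^c) *: u)) (h' := fun x => T u (r *: x))).
    + exact: raddfD.
    + by move=> x y; rewrite scalerDr; exact: raddfD.
    + by move=> i x; rewrite -linearZ_LR !TE; case: (tt i) => -[_ _ ->].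
  move: x; apply: (dsum_ext' (h := T (u + u')) (h' := fun x => T u x + T u' x)).
  - exact: raddfD.
  - by move=> x y; rewrite /T !raddfD addrACA.
  - by move=> i x; rewrite !TE; case: (tt i) => -[-> _ _] _; rewrite linearD.
have Ts : slinear T.
  move=> s c; apply: (dsum_ext' (h := T (s *: c)) (h' := fun x => s *: T c x)).
  - exact: raddfD.
  - by move=> x y; rewrite /T !raddfD.
  - by move=> i x; rewrite !TE st linearZ_LR.
exists T; split=> //; apply: tensor_of_slinear => // N G [GDl GDr GZ] sG.
have Gib i : balanced (fun c x => G c (dinj i x)).
  split=> [u u' x|u x x'|u r x]; first exact: GDl.
    by rewrite linearD GDr.
  by rewrite GZ linearZ_LR.
have /dep_choice[h hE] : forall i, exists h : {linear M i -> N},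
    (forall c x, h (t i c x) = G c (dinj i x)) /\
    (forall h' : {linear M i -> N}, (forall c x, h' (t i c x) = G c (dinj i x)) -> h' =1 h).
  move=> i; have [|h h1 h2] := tensor_slinear (tt i) (@st i) (Gib i); first by move=> s c x; apply: sG.
  by exists h.
have [H [HE HU]] := Lcop N h; exists H; split.
  move=> c; apply: (dsum_ext' (h := fun x => H (T c x)) (h' := G c)).
  - by move=> x y; rewrite -linearD; congr (H _); exact: raddfD.
  - exact: GDr.
  - by move=> i x; rewrite TE HE (hE i).1.
move=> h' h'E; apply: HU => i; apply: ((hE i).2 (h' \o g i : {linear _ -> _})) => c x /=.
by rewrite -TE h'E.
Qed.
End TensorClass.
End Semidualizing.

(** * Products *)

Section PresentedTensor.
Variables (R : pzRingType) (V : lmodType R^c) (F : lmodType R).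
Variables (K : finType) (c : K -> V).

Lemma generating_fin : (forall v, exists r : K -> R^c, v = \sum_k r k *: c k) ->
  generating c.
Proof.
move=> cS v; have [r ->] := cS v; exists (\sum_k dinj k (r k : (R^c)^o)).
by rewrite linear_sum; apply: eq_bigr => k _; rewrite eps_inj.
Qed.

Lemma tlift_fin (G : zmodType) (g : V -> F -> G) (hg : balanced g) psi :
  tlift c hg psi = \sum_k g (c k) (coord psi k).
Proof. exact: dlift_fin. Qed.

(** Right exactness in terms of elements: for V the cokernel of R^L -> R^K, the tensor product V (x)
    F is the cokernel of F^L -> F^K. In this finite form it can be compared with products. *)
Lemma presented_tensor (T : zmodType) (t : V -> F -> T) : presented c -> is_tensor t ->
  (forall z, exists x : K -> F, z = \sum_k t (c k) (x k)) /\
  (forall (L : finType) (b : L -> K -> R^c),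
    (forall r : K -> R^c, \sum_k r k *: c k = 0 ->
      exists s : L -> R^c, forall k, r k = \sum_l s l * b l k) ->
    forall x : K -> F, \sum_k t (c k) (x k) = 0 ->
      exists y : L -> F, forall k, x k = \sum_l (b l k : R) *: y l).
Proof.
move=> [cS _] tt; have cgen := generating_fin cS; split=> [z|L b bS x x0].
  have [psi ->] := tensor_generated cgen tt z.
  by exists (coord psi); rewrite tlift_fin.
have psiR : relations c (\sum_k dinj k (x k) : vecs F K).
  apply: (@tensor_vanish _ _ _ _ _ cgen _ _ tt); rewrite tlift_fin -[RHS]x0.
  by apply: eq_bigr => k _; rewrite coord_dsum_tuple.
have [n [k [y [k0 psiE]]]] := relations_fin psiR.
have /choice[s sE] : forall a, exists s : L -> R^c, forall j, coord (k a) j = \sum_l s l * b l j.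
  by move=> a; apply: bS; rewrite -[RHS](k0 a) eps_fin.
exists (fun l => \sum_a (s a l : R) *: y a) => j.
rewrite -[LHS](coord_dsum_tuple (M := fun=> F) x j) psiE coord_sum.
under [RHS]eq_bigr do rewrite scaler_sumr.
rewrite exchange_big; apply: eq_bigr => a _; rewrite coord_act sE.
rewrite (scaler_suml (R := R)); apply: eq_bigr => l _.
by rewrite scalerA.
Qed.

(** Converse of [presented_tensor]: a balanced map exhibiting T as that cokernel is universal, since
    every balanced [g] kills the image of F^L. *)
Lemma tensor_of_presented (T : zmodType) (t : V -> F -> T) (L : finType)
    (b : L -> K -> R^c) : balanced t ->
  (forall v, exists r : K -> R^c, v = \sum_k r k *: c k) ->
  (forall l, \sum_k b l k *: c k = 0) ->
  (forall z, exists x : K -> F, z = \sum_k t (c k) (x k)) ->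
  (forall x : K -> F, \sum_k t (c k) (x k) = 0 ->
      exists y : L -> F, forall k, x k = \sum_l (b l k : R) *: y l) ->
  is_tensor t.
Proof.
move=> bt cS cb tS tK; split=> // G g bg.
have [tDl tDr tZ] := bt; have [gDl gDr gZ] := bg.
have g0 (x : K -> F) : \sum_k t (c k) (x k) = 0 -> \sum_k g (c k) (x k) = 0.
  move=> /tK[y xE]; under eq_bigr do rewrite xE (balanced_sumr bg).
  rewrite exchange_big big1 // => l _; under eq_bigr do rewrite -gZ.
  by rewrite -(balanced_suml bg) cb balanced0l.
have sumB (H : zmodType) (u : V -> F -> H) (bu : balanced u) (x y : K -> F) :
    \sum_k u (c k) (x k - y k) = \sum_k u (c k) (x k) - \sum_k u (c k) (y k).
  rewrite -sumrB; apply: eq_bigr => k _; exact: (raddfB (mkadditive (balanced_morph bu (c k)))).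
have gE (x y : K -> F) : \sum_k t (c k) (x k) = \sum_k t (c k) (y k) ->
    \sum_k g (c k) (x k) = \sum_k g (c k) (y k).
  move=> E; apply/eqP; rewrite -subr_eq0 -sumB //; apply/eqP/g0.
  by rewrite sumB // E subrr.
have [x xE] := choice tS.
have hD : {morph (fun z => \sum_k g (c k) (x z k)) : z z' / z + z'}.
  move=> z z'; rewrite -big_split /=; under [RHS]eq_bigr do rewrite -gDr.
  apply: (gE _ (fun k => x z k + x z' k)); rewrite -xE.
  by under eq_bigr do rewrite tDr; rewrite big_split -!xE.
exists (mkadditive hD); split=> [v y|h' h'E z] /=.
  have [r vE] := cS v.
  rewrite (gE _ (fun k => (r k : R) *: y)).
    by under eq_bigr do rewrite -gZ; rewrite -(balanced_suml bg) -vE.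
  by rewrite -xE; under eq_bigr do rewrite -tZ; rewrite -(balanced_suml bt) -vE.
by rewrite {1}(xE z) raddf_sum; apply: eq_bigr => k _; rewrite h'E.
Qed.
End PresentedTensor.

Section ProductPoints.
Variables (A : pzRingType) (I : Type) (M : I -> lmodType A) (L : lmodType A).
Variable p : forall i, {linear L -> M i}.
Hypothesis Lp : is_product p.

(** An element is a linear map from the regular module, so the universal property of a product
    yields points, and in [product_ext] their equality. *)
Lemma product_point (y : forall i, M i) : exists z, forall i, p i z = y i.
Proof.
have lin i : linear (fun r : A^o => (r : A) *: y i).
  by move=> a r r'; rewrite scalerDl scalerA.
have [h [hE _]] := Lp (fun i => mklinear (lin i)).
by exists (h (1 : A^o)) => i; rewrite hE /= scale1r.
Qed.

Lemma product_ext z z' : (forall i, p i z = p i z') -> z = z'.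
Proof.
move=> E.
have lin (w : L) : linear (fun r : A^o => (r : A) *: w).
  by move=> a r r'; rewrite scalerDl scalerA.
have [h [_ hU]] := Lp (fun i => (p i \o mklinear (lin z) : {linear _ -> _})).
have E' i (r : A^o) : p i (mklinear (lin z') r) = (p i \o mklinear (lin z)) r.
  by rewrite /= !linearZ_LR E.
have := hU _ E' (1 : A^o); rewrite /= scale1r => ->.
have := hU (mklinear (lin z)) (fun i r => erefl) (1 : A^o).
by rewrite /= scale1r.
Qed.
End ProductPoints.

(** One presentation of C over R describes every [M i] as a cokernel of finite powers of [F i].
    Solving factor by factor gives the same description of [L] by powers of the product of the
    [F i]. *)
Lemma tensor_class_products (S R : pzRingType) (C : bimodule S R)
    (X : lmodType R -> Prop) : semidualizing C ->
    (forall (I : Type) (F : I -> lmodType R), (forall i, X (F i)) -> X (prodm F)) ->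
  closed_under_products (tensor_class C X).
Proof.
move=> hC Xp I M L p XM Lp.
have /dep_choice[F FE] : forall i, exists F, X F /\ is_left_tensor C F (M i).
  by move=> i; case: (XM i) => F; exists F.
have {FE}[XF FE] : (forall i, X (F i)) /\ forall i, is_left_tensor C (F i) (M i).
  by split=> i; case: (FE i).
have [t tE] := dep_choice FE.
have tt i : is_tensor (t i) by case: (tE i).
have st i : slinear (t i) by case: (tE i).
have [K [c cp]] := right_presented hC; have [cS [N [b [b0 bS]]]] := cp.
have /choice[T TE] : forall cx : bimod_right C * prodm F,
    exists z, forall i, p i z = t i cx.1 (cx.2 i).
  by move=> cx; apply: product_point.
have ext := product_ext Lp.
exists (prodm F); first exact: Xp.
exists (fun u x => T (u, x)); split; last first.
  by move=> s u x; apply: ext => i; rewrite linearZ_LR !TE st.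
have Tb : balanced (fun u x => T (u, x)).
  split=> [u u' x|u x x'|u r x]; apply: ext => i; rewrite ?linearD !TE /=; case: (tt i) => -[iD iD' iZ] _.
  - by rewrite iD.
  - by rewrite -iD'.
  - by rewrite iZ.
apply: (tensor_of_presented (c := c) (b := b)) => // [z|x x0].
  have /dep_choice[x xE] : forall i, exists x : K -> F i, p i z = \sum_k t i (c k) (x k).
    by move=> i; apply: (presented_tensor cp (tt i)).1.
  exists (fun k i => x i k); apply: ext => i; rewrite xE linear_sum.
  by apply: eq_bigr => k _; rewrite TE.
have /dep_choice[y yE] : forall i, exists y : N -> F i, forall k, x k i = \sum_l (b l k : R) *: y l.
  move=> i; apply: ((presented_tensor cp (tt i)).2 N b bS (fun k => x k i)).
  rewrite -[RHS](linear0 (p i)) -x0 linear_sum.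
  by apply: eq_bigr => k _; rewrite TE.
exists (fun l => (fun i => y i l) : prodm F) => k.
by apply: functional_extensionality_dep => i; rewrite yE prodm_sum.
Qed.

Lemma projective_retract (A : pzRingType) (E F : lmodType A) (i : {linear E -> F})
    (p : {linear F -> E}) : (forall x, p (i x) = x) -> projective F -> projective E.
Proof.
move=> pi Fp U V q f qS; have [g gE] := Fp U V q (f \o p : {linear _ -> _}) qS.
by exists (g \o i : {linear _ -> _}) => x /=; rewrite gE /= pi.
Qed.

Lemma projective_dsum (A : pzRingType) (I : Type) (P : I -> lmodType A) :
  (forall i, projective (P i)) -> projective (dsum P).
Proof.
move=> Pp U V q f qS.
have /dep_choice[g gE] : forall i, exists g : {linear P i -> U}, forall x, q (g x) = f (dinj i x).
  by move=> i; apply: (Pp i U V q (f \o dinj i : {linear _ -> _}) qS).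
exists (dllift g).
apply: (dsum_ext' (h := fun x => q (dllift g x)) (h' := f)) => [x y|x y|i x].
- by rewrite !linearD.
- by rewrite linearD.
- by rewrite dllift_inj gE.
Qed.

(** * Filtered colimits *)

Section FilteredColimits.
Variables (A : pzRingType) (J : small_category) (hJ : filtered J) (D : diagram A J).

(** The description by elements that later arguments need. To derive it from the universal property,
    a model with this description must first be constructed. *)
Definition is_elt_colimit (L : lmodType A) (g : forall i, {linear D i -> L}) :=
  [/\ is_cocone g, forall z, exists j, exists x, z = g j x
    & forall j x, g j x = 0 -> exists k (u : cat_hom j k), diag_map D u x = 0].

Lemma filtered_span (i j k : J) (u : cat_hom i j) (v : cat_hom i k) :
  exists (l : J) (a : cat_hom j l) (b : cat_hom k l), cat_comp u a = cat_comp v b.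
Proof.
have [_ up eqz] := hJ; have [l [[a] [b]]] := up j k.
have [m [w E]] := eqz _ _ (cat_comp u a) (cat_comp v b).
by exists m, (cat_comp a w), (cat_comp b w); rewrite !cat_compA.
Qed.

Lemma filtered_bound (K : finType) (j : K -> J) :
  exists k, forall i, inhabited (cat_hom (j i) k).
Proof.
have [[j0] up _] := hJ.
suff H (s : seq K) : exists k, forall i, i \in s -> inhabited (cat_hom (j i) k).
  by have [k kE] := H (enum K); exists k => i; apply: kE; rewrite mem_enum.
elim: s => [|i s [k IH]]; first by exists j0.
have [l [[a] [b]]] := up k (j i); exists l => i'; rewrite inE => /orP[/eqP ->|/IH[u]] //.
by split; exact: cat_comp u a.
Qed.

Definition stage : Type := {j : J & D j}.
Definition at_stage j (x : D j) : stage := existT _ j x.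

Definition stage_eq (p q : stage) :=
  exists (k : J) (u : cat_hom (projT1 p) k) (v : cat_hom (projT1 q) k),
    diag_map D u (projT2 p) = diag_map D v (projT2 q).

Lemma stage_eq_refl p : stage_eq p p.
Proof. by exists (projT1 p), (cat_id _), (cat_id _). Qed.
Lemma stage_eq_sym p q : stage_eq p q -> stage_eq q p.
Proof. by move=> [k [u [v E]]]; exists k, v, u. Qed.
Lemma stage_eq_trans p q r : stage_eq p q -> stage_eq q r -> stage_eq p r.
Proof.
move=> [k [u [v E]]] [k' [u' [v' E']]].
have [l [a [b ab]]] := filtered_span v u'.
exists l, (cat_comp u a), (cat_comp v' b).
by rewrite !diag_map_comp E -E' -!diag_map_comp ab.
Qed.

Lemma stage_eq_map j k (u : cat_hom j k) (x : D j) :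
  stage_eq (at_stage x) (at_stage (diag_map D u x)).
Proof. by exists k, u, (cat_id k); rewrite diag_map_id. Qed.

(** For addition to be well defined, one pair of maps has to witness both equalities: the two maps
    out of [m] are joined first, then the two resulting maps out of [k] are equalized. *)
Lemma stage_eq2 m k (p q : D m) (x y : D k) :
  stage_eq (at_stage p) (at_stage x) -> stage_eq (at_stage q) (at_stage y) ->
  exists n (s : cat_hom m n) (r : cat_hom k n),
    diag_map D s p = diag_map D r x /\ diag_map D s q = diag_map D r y.
Proof.
move=> [n1 [s1 [r1 /= E1]]] [n2 [s2 [r2 /= E2]]].
have [n [a1 [a2 a12]]] := filtered_span s1 s2.
have [_ _ eqz] := hJ.
have [n' [w wE]] := eqz _ _ (cat_comp r1 a1) (cat_comp r2 a2).
exists n', (cat_comp (cat_comp s1 a1) w), (cat_comp (cat_comp r1 a1) w).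
split; first by rewrite !diag_map_comp E1.
by rewrite a12 wE !diag_map_comp E2.
Qed.

Definition colim : Type := {P : stage -> Prop | exists p, P = stage_eq p}.

HB.instance Definition _ := gen_eqMixin colim.
HB.instance Definition _ := gen_choiceMixin colim.

Definition cclass (p : stage) : colim := exist _ (stage_eq p) (ex_intro _ p erefl).

Lemma cclass_eq p q : cclass p = cclass q <-> stage_eq p q.
Proof.
split=> [E|pq].
  have : sval (cclass p) q by rewrite E; apply: stage_eq_refl.
  by [].
apply: eq_exist; apply: funext => r; apply: propext.
by split; apply: stage_eq_trans => //; apply: stage_eq_sym.
Qed.

Definition cin j (x : D j) : colim := cclass (at_stage x).

Lemma cin_map j k (u : cat_hom j k) (x : D j) : cin (diag_map D u x) = cin x.
Proof. by apply/cclass_eq/stage_eq_sym/stage_eq_map. Qed.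

Lemma crep_ex (X : colim) : exists p : stage, X = cin (projT2 p).
Proof. by case: X => X [[j x] E]; exists (at_stage x); apply: eq_exist. Qed.

Lemma crep2 (X Y : colim) : exists j, exists p : D j * D j, X = cin p.1 /\ Y = cin p.2.
Proof.
have [[i x] ->] := crep_ex X; have [[j y] ->] := crep_ex Y.
have [_ up _] := hJ; have [k [[u] [v]]] := up i j.
by exists k, (diag_map D u x, diag_map D v y); rewrite !cin_map.
Qed.

Lemma crep3 (X Y Z : colim) : exists j, exists p : D j * D j * D j,
  [/\ X = cin p.1.1, Y = cin p.1.2 & Z = cin p.2].
Proof.
have [i [[x y] [-> ->]]] := crep2 X Y; have [[j z] ->] := crep_ex Z.
have [_ up _] := hJ; have [k [[u] [v]]] := up i j.
by exists k, (diag_map D u x, diag_map D u y, diag_map D v z); rewrite !cin_map.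
Qed.

Definition c_add (X Y : colim) : colim :=
  let r := cid (crep2 X Y) in let p := sval (cid (svalP r)) in cin (p.1 + p.2).
Definition c_opp (X : colim) : colim := cin (- projT2 (sval (cid (crep_ex X)))).
Definition c_scale (a : A) (X : colim) : colim :=
  cin (a *: projT2 (sval (cid (crep_ex X)))).

Lemma c_addE j (x y : D j) : c_add (cin x) (cin y) = cin (x + y).
Proof.
rewrite /c_add; case: (cid (crep2 _ _)) => m H /=.
case: (cid _) => -[p q] /= [/esym/cclass_eq px /esym/cclass_eq qy].
have [n [s [r [E1 E2]]]] := stage_eq2 px qy.
by apply/cclass_eq; exists n, s, r; rewrite /= !linearD E1 E2.
Qed.
Lemma c_oppE j (x : D j) : c_opp (cin x) = cin (- x).
Proof.
rewrite /c_opp; case: (cid _) => -[m p] /= /esym/cclass_eq[k [u [v E]]].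
by apply/cclass_eq; exists k, u, v; rewrite /= !linearN E.
Qed.
Lemma c_scaleE a j (x : D j) : c_scale a (cin x) = cin (a *: x).
Proof.
rewrite /c_scale; case: (cid _) => -[m p] /= /esym/cclass_eq[k [u [v E]]].
by apply/cclass_eq; exists k, u, v; rewrite /= !linearZ_LR E.
Qed.

Lemma stage_ex : exists j : J, True.
Proof. by case: hJ => -[j]; exists j. Qed.
Definition stage0 : J := sval (cid stage_ex).

Definition c_zero : colim := cin (0 : D stage0).
Lemma c_zeroE j : cin (0 : D j) = c_zero.
Proof.
have [_ up _] := hJ; have [k [[u] [v]]] := up j stage0.
by apply/cclass_eq; exists k, u, v; rewrite /= !linear0.
Qed.

Fact c_addA : associative c_add.
Proof.
move=> X Y Z; have [j [[[x y] z] /= [-> -> ->]]] := crep3 X Y Z.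
by rewrite !c_addE addrA.
Qed.
Fact c_addC : commutative c_add.
Proof. by move=> X Y; have [j [[x y] /= [-> ->]]] := crep2 X Y; rewrite !c_addE addrC. Qed.
Fact c_add0 : left_id c_zero c_add.
Proof. by move=> X; have [[j x] ->] := crep_ex X; rewrite -(c_zeroE j) c_addE add0r. Qed.
Fact c_addN : left_inverse c_zero c_opp c_add.
Proof. by move=> X; have [[j x] ->] := crep_ex X; rewrite c_oppE c_addE addNr c_zeroE. Qed.
HB.instance Definition _ := GRing.isZmodule.Build colim c_addA c_addC c_add0 c_addN.

Fact c_scaleA a b X : c_scale a (c_scale b X) = c_scale (a * b) X.
Proof. by have [[j x] ->] := crep_ex X; rewrite !c_scaleE scalerA. Qed.
Fact c_scale1 : left_id 1 c_scale.
Proof. by move=> X; have [[j x] ->] := crep_ex X; rewrite c_scaleE scale1r. Qed.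
Fact c_scaleDr : right_distributive c_scale +%R.
Proof.
move=> a X Y; have [j [[x y] /= [-> ->]]] := crep2 X Y.
have -> : cin x + cin y = cin (x + y) by exact: c_addE.
by rewrite !c_scaleE -[RHS]/(c_add _ _) c_addE scalerDr.
Qed.
Fact c_scaleDl X : {morph c_scale^~ X : a b / a + b}.
Proof.
move=> a b; have [[j x] ->] := crep_ex X.
by rewrite !c_scaleE -[RHS]/(c_add _ _) c_addE scalerDl.
Qed.
HB.instance Definition _ := GRing.Zmodule_isLmodule.Build A colim
  c_scaleA c_scale1 c_scaleDr c_scaleDl.

Fact cin_linear j : linear (@cin j).
Proof.
move=> a x y; rewrite -[LHS]c_addE -c_scaleE; exact: erefl.
Qed.

Lemma elt_colimit_exists : exists (L : lmodType A) (g : forall i, {linear D i -> L}),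
  is_elt_colimit g.
Proof.
exists colim, (fun j => mklinear (@cin_linear j)); split=> [i j u x|z|j x] /=.
- exact: cin_map.
- by have [[j x] ->] := crep_ex z; exists j, x.
- rewrite -[0]/c_zero -(c_zeroE j) => /cclass_eq[k [u [v /= E]]].
  by exists k, u; rewrite E linear0.
Qed.

Lemma elt_lift (L : lmodType A) (g : forall i, {linear D i -> L}) :
  is_elt_colimit g -> forall (N : lmodType A) (f : forall i, {linear D i -> N}),
  is_cocone f -> exists h : {linear L -> N}, forall i x, h (g i x) = f i x.
Proof.
move=> [gc gS g0] N f fc.
have [_ up _] := hJ.
(* Elements with the same image in [L] differ, at a common stage [k], by an element of the kernel of
   [g k], and some further map of the diagram kills it. *)
have wd i j (x : D i) (y : D j) : g i x = g j y -> f i x = f j y.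
  have [k [[u] [v]]] := up i j => E.
  have [|l [w wE]] := g0 k (diag_map D u x - diag_map D v y).
    by rewrite linearB !gc E subrr.
  apply/eqP; rewrite -subr_eq0 -(fc _ _ u) -(fc _ _ v) -linearB -(fc _ _ w) wE.
  by rewrite linear0.
have gS' z : exists p : stage, z = g _ (projT2 p).
  by have [j [x ->]] := gS z; exists (at_stage x).
have [p pE] := choice gS'.
have lin : linear (fun z => f _ (projT2 (p z))).
  move=> a z z'; have [k [[u] [v]]] := up (projT1 (p z)) (projT1 (p z')).
  rewrite -(fc _ _ u) -(fc _ _ v) -linearP; apply: wd.
  by rewrite -pE linearP !gc -!pE.
by exists (mklinear lin) => i x /=; apply: wd; rewrite -pE.
Qed.

(** By uniqueness [L] is a retract of the model, compatibly with both cocones: generation is carried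
    by [h'] from the model to [L], and vanishing by [h] from [L] to the model. *)
Lemma colimit_elt (L : lmodType A) (g : forall i, {linear D i -> L}) :
  is_colimit g -> is_elt_colimit g.
Proof.
move=> [gc gU]; have [L' [g' g'E]] := elt_colimit_exists; have [g'c g'S g'0] := g'E.
have [h [hE _]] := gU L' g' g'c.
have [h' h'E] := elt_lift g'E gc.
have [e [_ eU]] := gU L g gc.
have h'h z : h' (h z) = z.
  rewrite -[LHS]/((h' \o h : {linear _ -> _}) z) (eU (h' \o h : {linear _ -> _})).
    by rewrite -(eU idfun).
  by move=> i x /=; rewrite hE h'E.
split=> // [z|j x x0].
  by have [j [x E]] := g'S (h z); exists j, x; rewrite -h'E -E h'h.
by apply: g'0; rewrite -hE x0 linear0.
Qed.

Section HomsFromPresented.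
Variables (L : lmodType A) (g : forall i, {linear D i -> L}) (gL : is_elt_colimit g).

Lemma elt_colimit_family (K : finType) (z : K -> L) :
  exists j, exists y : K -> D j, forall k, z k = g j (y k).
Proof.
have [gc gS _] := gL.
have /choice[p pE] : forall k, exists p : stage, z k = g _ (projT2 p).
  by move=> k; have [j [x ->]] := gS (z k); exists (at_stage x).
have [j jE] := filtered_bound (fun k => projT1 (p k)).
have /choice[y yE] : forall k, exists y : D j, z k = g j y.
  by move=> k; have [u] := jE k; exists (diag_map D u (projT2 (p k))); rewrite gc.
by exists j, y.
Qed.

Lemma elt_colimit_vanish (K : finType) j (y : K -> D j) : (forall k, g j (y k) = 0) ->
  exists k (u : cat_hom j k), forall i, diag_map D u (y i) = 0.
Proof.
have [gc _ g0] := gL => y0.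
suff H (s : seq K) : exists k (u : cat_hom j k), forall i, i \in s -> diag_map D u (y i) = 0.
  by have [k [u uE]] := H (enum K); exists k, u => i; apply: uE; rewrite mem_enum.
elim: s => [|i s [k [u IH]]]; first by exists j, (cat_id j).
have [|l [v vE]] := g0 k (diag_map D u (y i)); first by rewrite gc.
exists l, (cat_comp u v) => i'; rewrite inE diag_map_comp => /orP[/eqP -> //|/IH ->].
by rewrite linear0.
Qed.

Lemma hom_vanish (M : lmodType A) (K : finType) (c : K -> M) j (psi : {linear M -> D j}) :
    (forall x, exists r : K -> A, x = \sum_k r k *: c k) ->
    (forall x, g j (psi x) = 0) ->
  exists k (u : cat_hom j k), forall x, diag_map D u (psi x) = 0.
Proof.
move=> cS psi0; have [k [u uE]] := elt_colimit_vanish (fun i => psi0 (c i)).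
exists k, u => x; have [r ->] := cS x; rewrite !linear_sum big1 // => i _.
by rewrite !linearZ_LR uE scaler0.
Qed.

(** The values on the generators are lifted to one stage and moved on until the finitely many
    relations hold there. *)
Lemma hom_lift (M : lmodType A) (K : finType) (c : K -> M) (phi : {linear M -> L}) :
    presented c ->
  exists j, exists psi : {linear M -> D j}, forall x, phi x = g j (psi x).
Proof.
move=> [cS [N [b [b0 bS]]]]; have [gc gS g0] := gL.
have [j [y yE]] := elt_colimit_family (fun k => phi (c k)).
have [|k [u uE]] := elt_colimit_vanish (y := fun l => \sum_k b l k *: y k).
  move=> l; rewrite linear_sum; under eq_bigr do rewrite linearZ_LR -yE -linearZ_LR.
  by rewrite -linear_sum b0 linear0.
have [|psi psiE] := presented_lift (w := fun i => diag_map D u (y i)) cS.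
  move=> r /bS[s sE]; under eq_bigr do rewrite sE scaler_suml.
  rewrite exchange_big big1 // => l _; under eq_bigr do rewrite -scalerA -linearZ_LR.
  by rewrite -scaler_sumr -linear_sum uE scaler0.
exists k, psi.
apply: (generators_ext (g := (g k \o psi : {linear _ -> _})) cS) => i /=.
by rewrite psiE gc -yE.
Qed.

Lemma hom_lift_family (M : lmodType A) (K : finType) (c : K -> M) (I : finType)
    (phi : I -> {linear M -> L}) : presented c ->
  exists j, exists psi : I -> {linear M -> D j}, forall i x, phi i x = g j (psi i x).
Proof.
move=> cp; have [gc _ _] := gL.
have /choice[p pE] : forall i, exists p : {j & {linear M -> D j}},
    forall x, phi i x = g _ (projT2 p x).
  by move=> i; have [j [psi E]] := hom_lift (phi i) cp; exists (existT _ j psi).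
have [j jE] := filtered_bound (fun i => projT1 (p i)).
have /choice[psi psiE] : forall i, exists psi : {linear M -> D j}, forall x, phi i x = g j (psi x).
  move=> i; have [u] := jE i; exists (diag_map D u \o projT2 (p i) : {linear _ -> _}) => x /=.
  by rewrite gc.
by exists j, psi.
Qed.
End HomsFromPresented.
End FilteredColimits.

(* Hom_S(C, L) is the filtered colimit of the Hom_S(C, C (x) F_j) = F_j because
   C is finitely presented over S, so it is flat and L = C (x) Hom_S(C, L). *)
Lemma tensor_class_filtered_colimits (S R : pzRingType) (C : bimodule S R) :
  semidualizing C -> closed_under_filtered_colimits (tensor_class C (@eqflat R)).
Proof.
move=> hC J D L g hJ XD Lcol.
have /dep_choice[F FE] : forall i, exists F, eqflat F /\ is_left_tensor C F (D i).
  by move=> i; case: (XD i) => F; exists F.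
have {FE}[Ff FE] : (forall i, eqflat (F i)) /\ forall i, is_left_tensor C (F i) (D i).
  by split=> i; case: (FE i).
have [t tE] := dep_choice FE.
have tt i : is_tensor (t i) by case: (tE i).
have st i : slinear (t i) by case: (tE i).
have gL := colimit_elt hJ Lcol; have [gc gS g0] := gL.
have [K [d dp]] := left_presented hC; have dS := dp.1.
(* Since F is Hom_S(C, C (x) F), the transition maps of D come from the modules F; their values
   suffice and no diagram of the F needs to be formed. *)
have push j k (u : cat_hom j k) (x : F j) :
    exists x' : F k, forall c, diag_map D u (t j c x) = t k c x'.
  have lin : linear (fun c : C => diag_map D u (t j c x)).
    by move=> a v v'; rewrite -linearP -[in RHS]st; case: (tt j) => -[-> _ _] _.
  exact: (tensor_at_surj hC (Ff k) (tt k) (@st k) (mklinear lin)).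
have glin j (x : F j) : linear (fun c : C => g j (t j c x)).
  by move=> a v v'; rewrite -linearP -[in RHS]st; case: (tt j) => -[-> _ _] _.
pose eta j x : homC C L := mklinear (glin j x).
have lift (I : finType) (phi : I -> homC C L) :
    exists j, exists x : I -> F j, forall i c, hc_fun (phi i) c = g j (t j c (x i)).
  have [j [psi psiE]] := hom_lift_family hJ gL (fun i => phi i : {linear bimod_left C -> L}) dp.
  have /choice[x xE] : forall i, exists x, forall c : C, psi i c = t j c x.
    by move=> i; apply: (tensor_at_surj hC (Ff j) (tt j) (@st j) (psi i : homC C (D j))).
  by exists j, x => i c; rewrite -xE -psiE.
exists (homC C L).
  move=> I r phi rphi; have [j [x xE]] := lift I phi.
  (* The relation among the [phi i] need not hold between their lifts at stage [j]. Since C is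
     finitely generated it holds at a later stage [k], where flatness of [F k] factors it. *)
  pose xi := \sum_i r i *: x i.
  have txi c : t j c xi = \sum_i t j (bimod_act c (r i)) (x i).
    by rewrite (balanced_sumr (tt j).1); apply: eq_bigr => i _; case: (tt j) => -[_ _ <-].
  have [|k [u uE]] := hom_vanish gL (psi := tensor_at (tt j) (@st j) xi) dS.
    move=> c; rewrite -[tensor_at _ _ _ c]/(t j c xi) txi linear_sum.
    under eq_bigr do rewrite -xE -homCZ.
    by rewrite -homC_sum rphi homC0.
  have /choice[x' x'E] : forall i, exists x', forall c, diag_map D u (t j c (x i)) = t k c x'.
    by move=> i; apply: push.
  have [|Q [a [y [yE ra]]]] := Ff k I r x'.
    apply: (tensor_at_inj hC (Ff k) (tt k)) => c.
    rewrite -[RHS](uE c) -[tensor_at _ _ _ c]/(t j c xi) txi linear_sum (balanced_sumr (tt k).1).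
    by apply: eq_bigr => i _; rewrite x'E; case: (tt k) => -[_ _ <-].
  exists Q, a, (fun q => eta k (y q)); split=> // i; apply: homC_ext => c.
  rewrite xE -(gc _ _ u) x'E yE (balanced_sumr (tt k).1) linear_sum homC_sum.
  by apply: eq_bigr => q _; rewrite homCZ /hc_fun /=; case: (tt k) => -[_ _ <-].
exists (fun c phi => hc_fun phi c); split=> [|s c phi]; last by rewrite /hc_fun linearZ_LR.
apply: tensor_of_slinear.
- by split=> // u u' phi; rewrite /hc_fun; exact: (linearD (phi : {linear C -> L})).
- by move=> s c phi; rewrite /hc_fun linearZ_LR.
move=> N G [GDl GDr GZ] sG.
have etaD j : linear (eta j).
  move=> a x y; apply: homC_ext => c; rewrite homCD homCZ /hc_fun /= -linearD.
  by congr (g j _); case: (tt j) => -[_ -> <-].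
have Gb j : balanced (fun c (x : F j) => G c (eta j x)).
  have eD := linearD (mklinear (etaD j)); have eZ := linearZ_LR (mklinear (etaD j)).
  split=> [u u' x|u x x'|u r x]; first exact: GDl.
    by rewrite -GDr; congr G; exact: eD.
  by rewrite GZ; congr G; exact: (esym (eZ r x)).
have /dep_choice[h hE] : forall j, exists h : {linear D j -> N},
    (forall c x, h (t j c x) = G c (eta j x)) /\
    (forall h' : {linear D j -> N}, (forall c x, h' (t j c x) = G c (eta j x)) -> h' =1 h).
  move=> j; have [|h h1 h2] := tensor_slinear (tt j) (@st j) (Gb j); first by move=> s c x; apply: sG.
  by exists h.
have hc : is_cocone h.
  move=> j k u; apply: ((hE j).2 (h k \o diag_map D u : {linear _ -> _})) => c x /=.
  have [x' x'E] := push j k u x; rewrite x'E (hE k).1; congr G.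
  by apply: homC_ext => c'; rewrite /hc_fun /= -x'E gc.
have [H [HE HU]] := Lcol.2 N h hc; exists H; split=> [c phi|h' h'E].
  have [j [x xE]] := lift 'I_1 (fun=> phi).
  by rewrite (xE 0) HE (hE j).1; congr G; apply: homC_ext => c'; rewrite (xE 0).
apply: HU => j; apply: ((hE j).2 (h' \o g j : {linear _ -> _})) => c x /=.
by rewrite -h'E.
Qed.

(** * Injective modules *)

Lemma injective_retract (A : pzRingType) (E F : lmodType A) (i : {linear E -> F})
    (p : {linear F -> E}) :
  (forall x, p (i x) = x) -> injective_module F -> injective_module E.
Proof.
move=> pi Fi U V j f jI; have [g gE] := Fi U V j (i \o f : {linear _ -> _}) jI.
by exists (p \o g : {linear _ -> _}) => x /=; rewrite gE /= pi.
Qed.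

Lemma injective_prod (A : pzRingType) (I : Type) (E : I -> lmodType A) :
  (forall i, injective_module (E i)) -> injective_module (prodm E).
Proof.
move=> Ei U V j f jI.
have /dep_choice[g gE] : forall i, exists g : {linear V -> E i}, forall x, g (j x) = f x i.
  by move=> i; apply: (Ei i U V j (prodm_proj E i \o f : {linear _ -> _}) jI).
exists (prodm_pair g) => x; apply: functional_extensionality_dep => i; exact: gE.
Qed.

Section ExtensionFromImage.
Variables (A : pzRingType) (V W : lmodType A) (B : {linear V -> W}).

Fact image0 : exists v, B v = 0.
Proof. by exists 0; rewrite linear0. Qed.
Fact imageD x y : (exists v, B v = x) -> (exists v, B v = y) -> exists v, B v = x + y.
Proof. by move=> [v <-] [w <-]; exists (v + w); rewrite linearD. Qed.
Fact imageZ a x : (exists v, B v = x) -> exists v, B v = a *: x.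
Proof. by move=> [v <-]; exists (a *: v); rewrite linearZ_LR. Qed.
Definition image_submod : submod W := Submod image0 imageD imageZ.

(** Exactness of Hom(-, E) at V: [f] descends to the image of [B] and extends from there by
    injectivity. *)
Lemma injective_factor (E : lmodType A) (f : {linear V -> E}) : injective_module E ->
  (forall v, B v = 0 -> f v = 0) -> exists h : {linear W -> E}, forall v, h (B v) = f v.
Proof.
move=> Ei Bf.
have wd v w : B v = B w -> f v = f w.
  by move=> E'; apply/eqP; rewrite -subr_eq0 -linearB; apply/eqP/Bf; rewrite linearB E' subrr.
have /choice[v vE] : forall x : submod_of image_submod, exists v, B v = sval x.
  by case=> w [v vE]; exists v.
have lin : linear (fun x => f (v x)).
  by move=> a x y; rewrite -linearP; apply: wd; rewrite linearP !vE.
have [h hE] := Ei _ _ (submod_val image_submod) (mklinear lin) (@submod_val_inj _ _ _).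
exists h => w; pose x : submod_of image_submod := exist _ (B w) (ex_intro _ w erefl).
by rewrite -[B w]/(submod_val image_submod x) hE /=; apply: wd; rewrite vE.
Qed.
End ExtensionFromImage.

(** Zorn's lemma on graphs of partial maps extending [f] along [i]. If a maximal graph missed [v0],
    the coefficients [a] with [a *: v0] in its domain would form a left ideal; the hypothesis gives
    [e0] representing the map on it, and sending [v0] to [e0] would enlarge the graph. *)
Lemma baer_criterion (A : pzRingType) (E : lmodType A) :
  (forall (J : submod (A^o : lmodType A)) (f : {linear submod_of J -> E}),
    exists e, forall x, f x = (sval x : A) *: e) ->
  injective_module E.
Proof.
move=> baer U V i f iI.
pose good (G : set (V * E)) := [/\ forall u, G (i u, f u),
  forall p q, G p -> G q -> G (p.1 + q.1, p.2 + q.2),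
  forall a p, G p -> G (a *: p.1, a *: p.2) & forall e, G (0, e) -> e = 0].
(* Only a nonempty graph has to be good, because the union of the empty chain is empty. *)
pose nice (G : set (V * E)) := forall p, G p -> good G.
have [|G [PG Gmax]] := @Zorn_bigcup _ nice.
  move=> F FP tot p0 [X0 FX0 X0p].
  have gX X p : F X -> X p -> good X by move=> FX; apply: FP.
  split=> [u|p q [X FX Xp] [Y FY Yq]|a p [X FX Xp]|e [X FX Xe]].
  - by exists X0 => //; have [+ _ _ _] := gX X0 p0 FX0 X0p; apply.
  - have [XY|YX] := tot X Y FX FY.
      by exists Y => //; have [_ + _ _] := gX Y q FY Yq; apply=> //; apply: XY.
    by exists X => //; have [_ + _ _] := gX X p FX Xp; apply=> //; apply: YX.
  - by exists X => //; have [_ _ + _] := gX X p FX Xp; apply.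
  - by have [_ _ _ +] := gX X _ FX Xe; apply.
have goodG : good G.
  have [[p Gp]|nG] := pselect (exists p, G p); first exact: PG Gp.
  (* A maximal graph cannot be empty, since the graph of [f] itself lies strictly above the empty
     one. *)
  pose base : set (V * E) := fun p => exists u, p = (i u, f u).
  exfalso; apply: (Gmax base).
    split=> [p Gp|/(_ (i 0, f 0))]; first by exfalso; apply: nG; exists p.
    by move=> H; apply: nG; exists (i 0, f 0); apply: H; exists 0.
  move=> _ _; split=> [u|p q [u ->] [u' ->]|a p [u ->]|e [u [E1 ->]]].
  - by exists u.
  - by exists (u + u'); rewrite !linearD.
  - by exists (a *: u); rewrite !linearZ_LR.
  - suff -> : u = 0 by rewrite linear0.
    by apply: iI; rewrite linear0.
have [Gb GD GZ G0] := goodG.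
have Gfun v e e' : G (v, e) -> G (v, e') -> e = e'.
  move=> Ge Ge'; apply/eqP; rewrite -subr_eq0; apply/eqP/G0.
  have := GD _ _ Ge (GZ (- 1) _ Ge'); rewrite /= !scaleN1r.
  by rewrite subrr.
have total v0 : exists e, G (v0, e).
  apply/not_existsP => nv0.
  pose inJ (a : A^o) := exists e, G ((a : A) *: v0, e).
  have J0 : inJ 0.
    by exists 0; rewrite (scale0r v0) -[0 in X in G X](scale0r v0); have := GZ 0 _ (Gb 0); rewrite /= !scale0r.
  have JD a b : inJ a -> inJ b -> inJ (a + b).
    by move=> [e Ge] [e' Ge']; exists (e + e'); rewrite scalerDl; apply: (GD _ _ Ge Ge').
  have JZ (r : A) a : inJ a -> inJ (r *: a).
    by move=> [e Ge]; exists (r *: e); rewrite -scalerA; apply: (GZ r _ Ge).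
  pose J := Submod J0 JD JZ.
  have /choice[h hE] : forall x : submod_of J, exists e, G ((sval x : A) *: v0, e).
    by case=> a [e Ge]; exists e.
  have hlin : linear h.
    move=> a x y; apply: (Gfun ((a * sval x + sval y : A) *: v0)); first exact: (hE (a *: x + y)).
    by rewrite scalerDl -scalerA; apply: (GD _ _ (GZ a _ (hE x)) (hE y)).
  have [e0 e0E] := baer J (mklinear hlin).
  (* The extension of G sending v0 to e0. *)
  pose H : set (V * E) := fun p => exists v e a, G (v, e) /\ p = (v + a *: v0, e + a *: e0).
  apply: (Gmax H).
    split=> [[v e] Ge|HG]; first by exists v, e, 0; rewrite !scale0r !addr0.
    apply: (nv0 e0); apply: HG; exists (i 0), (f 0), 1; split=> //.
    by rewrite !linear0 !add0r !scale1r.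
  move=> _ _; split=> [u|p q [v [e [a [Ge ->]]]] [v' [e' [a' [Ge' ->]]]]|b p [v [e [a [Ge ->]]]]|e].
  - by exists (i u), (f u), 0; rewrite !scale0r !addr0.
  - exists (v + v'), (e + e'), (a + a'); split; first exact: (GD _ _ Ge Ge').
    by rewrite /= !scalerDl; congr pair; exact: addrACA.
  - exists (b *: v), (b *: e), (b * a); split; first exact: (GZ b _ Ge).
    by rewrite /= !scalerDr !scalerA.
  (* If v + a v0 = 0, then [a] lies in the ideal and the old graph sends a v0 = -v to -e'. By the
     choice of [e0] this value is a e0, so the new value e' + a e0 is 0. *)
  - move=> [v [e' [a [Ge [/esym vE ->]]]]].
    have av : a *: v0 = - v by apply/eqP; rewrite -addr_eq0 addrC vE.
    have Gav : G (a *: v0, - e').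
      by rewrite av -[- v]scaleN1r -[- e']scaleN1r; apply: (GZ _ _ Ge).
    have Ja : inJ a by exists (- e').
    have := e0E (exist _ (a : A^o) Ja : submod_of J) => /= hE'.
    by rewrite -hE' (Gfun _ _ _ (hE (exist _ (a : A^o) Ja : submod_of J)) Gav) subrr.
have [g gE] := choice total.
have glin : linear g.
  move=> a v w; apply: (Gfun (a *: v + w)); first exact: gE.
  exact: (GD _ _ (GZ a _ (gE v)) (gE w)).
by exists (mklinear glin) => u /=; apply: (Gfun (i u)).
Qed.

(** * Injective modules over a left noetherian ring *)

Section Noetherian.
Variable A : pzRingType.
Hypothesis An : left_noetherian A.

Lemma left_ideal_fg (J : submod (A^o : lmodType A)) :
  exists (K : finType) (a : K -> submod_of J),
    forall x, exists r : K -> A, x = \sum_k r k *: a k.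
Proof. by apply: fg_generators; apply: (An (@submod_val_inj _ _ J)). Qed.

(** Induction on the list of coordinates allowed to be nonzero: the k-th coordinates form a left
    ideal, and lifts of its generators together with generators of the tuples vanishing at k
    generate [P]. *)
Lemma noetherian_tuples (K : finType) (s : seq K)
    (P : submod (prodm (fun _ : K => A^o : lmodType A))) :
  (forall r k, P r -> k \notin s -> r k = 0) ->
  exists (L : finType) (b : L -> prodm (fun _ : K => A^o : lmodType A)),
    (forall l, P (b l)) /\ forall r, P r -> exists t : L -> A, r = \sum_l t l *: b l.
Proof.
elim: s P => [|k s IH] P Ps.
  exists 'I_0, (fun=> 0); split=> [l|r Pr]; first exact: submod0.
  exists (fun=> 0); rewrite big_ord0; apply: functional_extensionality_dep => k.
  exact: Ps.
pose inI (a : A^o) := exists r, P r /\ r k = a.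
have I0 : inI 0 by exists 0; split=> //; apply: submod0.
have ID a b : inI a -> inI b -> inI (a + b).
  by move=> [r [Pr <-]] [r' [Pr' <-]]; exists (r + r'); split=> //; apply: submodD.
have IZ (c : A) a : inI a -> inI (c *: a).
  by move=> [r [Pr <-]]; exists (c *: r); split=> //; apply: submodZ.
have [M [a aE]] := left_ideal_fg (Submod I0 ID IZ).
have /choice[w wE] : forall m, exists r, P r /\ r k = sval (a m) by move=> m; case: (a m) => z [r [Pr rk]]; exists r.
pose inP (r : prodm (fun _ : K => A^o : lmodType A)) := P r /\ r k = 0.
have P0 : inP 0 by split=> //; apply: submod0.
have PD r r' : inP r -> inP r' -> inP (r + r').
  move=> [Pr r0] [Pr' r'0]; split; first exact: submodD.
  by rewrite -[LHS]/(r k + r' k) r0 r'0 addr0.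
have PZ (c : A) r : inP r -> inP (c *: r).
  move=> [Pr r0]; split; first exact: submodZ.
  by rewrite -[LHS]/(c *: r k) r0 scaler0.
have [|L [b [bP bS]]] := IH (Submod P0 PD PZ).
  move=> r k' [Pr rk] k's; have [->//|kk'] := eqVneq k' k.
  by apply: Ps => //; rewrite inE negb_or kk'.
exists (M + L)%type, (fun l => match l with inl m => w m | inr l => b l end).
split=> [[m|l]|r Pr]; [by case: (wE m) | by case: (bP l) |].
have Irk : inI (r k) by exists r.
have [t tE] := aE (exist _ (r k) Irk).
have [|t' t'E] := bS (r - \sum_m t m *: w m).
  split.
    apply: submodD => //; apply: submodN; apply: submod_sum => m; apply: submodZ.
    by case: (wE m).
  rewrite -[LHS]/(r k - (\sum_m t m *: w m) k) prodm_sum.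
  have -> : r k = \sum_m t m *: sval (a m).
    by have := congr1 sval tE; rewrite submod_of_sum.
  rewrite -sumrB big1 // => m _; case: (wE m) => _ <-.
  by rewrite -[(t m *: w m) k]/(t m *: w m k) subrr.
exists (fun l => match l with inl m => t m | inr l => t' l end).
by rewrite big_sumType /= -t'E addrC subrK.
Qed.

Lemma noetherian_presented (M : lmodType A) (K : finType) (c : K -> M) :
  (forall x, exists r : K -> A, x = \sum_k r k *: c k) -> presented c.
Proof.
move=> cS; split=> //.
pose inP (r : prodm (fun _ : K => A^o : lmodType A)) := \sum_k (r k : A) *: c k = 0.
have P0 : inP 0 by rewrite /inP big1 // => k _; apply: scale0r.
have PD r r' : inP r -> inP r' -> inP (r + r').
  rewrite /inP => r0 r'0; transitivity (\sum_k (r k : A) *: c k + \sum_k (r' k : A) *: c k).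
    by rewrite -big_split; apply: eq_bigr => k _; apply: scalerDl.
  by rewrite r0 r'0 addr0.
have PZ (a : A) r : inP r -> inP (a *: r).
  rewrite /inP => r0; rewrite -[RHS](scaler0 _ a) -[in RHS]r0 scaler_sumr.
  by apply: eq_bigr => k _; rewrite scalerA.
have [|L [b [bP bS]]] := noetherian_tuples (s := enum K) (P := Submod P0 PD PZ).
  by move=> r k _; rewrite mem_enum.
exists L, (fun l k => b l k); split=> // r /bS[t tE]; exists t => k.
by have := congr1 (fun f : prodm (fun _ : K => A^o : lmodType A) => f k) tE; rewrite prodm_sum.
Qed.

Lemma injective_point (E : lmodType A) (J : submod (A^o : lmodType A))
    (f : {linear submod_of J -> E}) :
  injective_module E -> exists e, forall x, f x = (sval x : A) *: e.
Proof.
move=> Ei; have [g gE] := Ei _ _ (submod_val J) f (@submod_val_inj _ _ _).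
exists (g (1 : A^o)) => x; rewrite -gE -linearZ_LR; congr (g _).
by rewrite -[RHS]/((sval x : A) * 1) mulr1.
Qed.

(** A finitely generated ideal maps into finitely many summands, so the elements representing the
    components of [f] combine into a finite sum. *)
Lemma noetherian_injective_dsum (I : Type) (E : I -> lmodType A) :
  (forall i, injective_module (E i)) -> injective_module (dsum E).
Proof.
move=> Ei; apply: baer_criterion => J f.
have [K [a aS]] := left_ideal_fg J.
have [s [us sf]] := common_support (fun k => f (a k)).
have /dep_choice[e eE] : forall i, exists e : E i, forall x, coord (f x) i = (sval x : A) *: e.
  by move=> i; apply: (injective_point (dproj E i \o f : {linear _ -> _}) (Ei i)).
exists (\sum_(i <- s) dinj i (e i)) => x; move: x.
have lin : linear (fun x : submod_of J => (sval x : A) *: \sum_(i <- s) dinj i (e i)).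
  by move=> b x y; rewrite -[sval _]/(b * sval x + sval y) scalerDl scalerA.
apply: (generators_ext (g := mklinear lin) aS) => k /=.
rewrite [LHS](dsum_decomp us); last by move=> i; apply: sf.
by rewrite scaler_sumr; apply: eq_bigr => i _; rewrite eE linearZ_LR.
Qed.

(** An ideal is finitely presented, so a map from it to the colimit factors through one [D j], where
    injectivity represents it by an element. *)
Lemma noetherian_injective_colimit (J : small_category) (D : diagram A J)
    (L : lmodType A) (g : forall i, {linear D i -> L}) : filtered J ->
  is_elt_colimit g -> (forall i, injective_module (D i)) -> injective_module L.
Proof.
move=> hJ gL Di; apply: baer_criterion => I f.
have [K [a aS]] := left_ideal_fg I.
have [j [psi psiE]] := hom_lift hJ gL f (noetherian_presented aS).
have [e eE] := injective_point psi (Di j).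
by exists (g j e) => x; rewrite psiE eE linearZ_LR.
Qed.
End Noetherian.

(** * The class I_C *)

Section InjectiveClass.
Variables (S R : pzRingType) (C : bimodule S R).

Lemma bimod_act0 (r : R) : bimod_act (0 : C) r = 0.
Proof. by apply: (addrI (bimod_act 0 r)); rewrite -bimod_actDl !addr0. Qed.

Lemma left_homP (E : lmodType S) (N : lmodType R) : is_left_hom C E N <->
  exists phi : {linear N -> homC C E},
    (forall x, phi x = 0 -> x = 0) /\ (forall f, exists x, phi x = f).
Proof.
split=> [[phi [phiD phiZ phiB]]|[phi [phi0 phiS]]].
  have lin : linear (fun x => phi x : homC C E).
    move=> a x y; apply: homC_ext => c.
    by rewrite homCD homCZ /hc_fun phiD phiZ.
  exists (mklinear lin); split=> [x x0|f].
    have [y [_ yU]] := phiB (0 : homC C E).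
    rewrite -(yU x) => [|c]; last by rewrite -[phi x]/(mklinear lin x) x0.
    apply: yU => c; rewrite -[phi 0]/(mklinear lin 0) linear0.
    by [].
  by have [x [xE _]] := phiB f; exists x; apply: homC_ext => c; apply: xE.
exists (fun x => phi x : {linear bimod_left C -> E}); split=> [x y c|r x c|f].
- by rewrite linearD.
- by rewrite linearZ_LR.
have [x xE] := phiS (f : homC C E); exists x; split=> [c|y yE].
  by rewrite xE.
apply/eqP; rewrite -subr_eq0; apply/eqP/phi0; rewrite linearB xE; apply/eqP.
rewrite subr_eq0; apply/eqP/esym; exact: linear_ext yE.
Qed.

Fact homC_post_lin (E E' : lmodType S) (h : {linear E -> E'}) :
  linear (fun f : homC C E => (h \o (f : {linear bimod_left C -> E}) : {linear _ -> _}) : homC C E').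
Proof. by move=> a f g; apply: homC_ext => c; rewrite /hc_fun /= linearD. Qed.
Definition homC_post E E' h : {linear homC C E -> homC C E'} :=
  mklinear (@homC_post_lin E E' h).
Lemma homC_postE (E E' : lmodType S) (h : {linear E -> E'}) f c :
  hc_fun (homC_post h f) c = h (hc_fun f c).
Proof. by []. Qed.

Lemma injective_C_products : closed_under_products (injective_C C).
Proof.
move=> I N L p NI Lp.
have /dep_choice[E EE] : forall i, exists E, injective_module E /\ is_left_hom C E (N i).
  by move=> i; case: (NI i) => E; exists E.
have Ei i := (EE i).1; have Eh i := (left_homP _ _).1 (EE i).2.
have {Eh}[phi phiE] := dep_choice Eh.
exists (prodm E); first exact: injective_prod.
apply/left_homP.
have clin z : linear (fun c => (fun i => hc_fun (phi i (p i z)) c) : prodm E).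
  move=> a c c'; apply: functional_extensionality_dep => i.
  by rewrite /hc_fun linearP.
have plin : linear (fun z => mklinear (clin z) : homC C (prodm E)).
  move=> a z z'; apply: homC_ext => c; apply: functional_extensionality_dep => i.
  by rewrite /hc_fun /= !linearP.
exists (mklinear plin); split=> [z z0|f].
  apply: (product_ext Lp) => i; rewrite linear0; apply: (phiE i).1; apply: homC_ext => c.
  have := congr1 (fun f : homC C (prodm E) => hc_fun f c i) z0; exact.
have /dep_choice[x xE] : forall i, exists x, phi i x = homC_post (prodm_proj E i) f.
  by move=> i; apply: (phiE i).2.
have [z zE] := product_point Lp x; exists z.
apply: homC_ext => c; apply: functional_extensionality_dep => i.
by rewrite /hc_fun /= zE xE.
Qed.

Hypothesis hC : semidualizing C.

Lemma left_faithful (s : S) : (forall c : C, s *: c = 0) -> s = 0.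
Proof.
move=> s0.
have lin0 : linear (fun _ : bimod_right C => 0 : bimod_right C).
  by move=> a x y; rewrite scaler0 addr0.
have [s' [_ U]] := sd_left_homothety hC (mklinear lin0).
rewrite -(U s) => [|c]; last by rewrite s0.
by apply: U => c; rewrite scale0r.
Qed.

Lemma scaler_right_sum (s : S) (K : finType) (r : K -> R^c) (c : K -> bimod_right C) :
  s *: (\sum_k r k *: c k : C) = \sum_k r k *: (s *: (c k : C) : bimod_right C).
Proof.
rewrite -[LHS]/(( *:%R s : C -> C) (\sum_k r k *: c k : bimod_right C)).
have D : {morph (fun c : bimod_right C => s *: (c : C) : bimod_right C) : x y / x + y}.
  by move=> x y; apply: (scalerDr s (x : C) (y : C)).
rewrite -[LHS]/(mkadditive D (\sum_k r k *: c k)) raddf_sum.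
by apply: eq_bigr => k _; rewrite /=; apply: (esym (bimod_actZ _ _ _)).
Qed.

Section HomFromInjective.
Variables (E : lmodType S) (K : finType) (c : K -> bimod_right C).
Hypotheses (Ei : injective_module E) (cp : presented c).

Let tuples : lmodType S := dsum (fun _ : K => bimod_left C).

(* Apply Hom(-, E) to the injection S -> C^K, s |-> (s c_k)_k. *)
Lemma injective_evaluations e :
  exists alpha : K -> homC C E, e = \sum_k hc_fun (alpha k) (c k).
Proof.
have lin : linear (fun s : S^o => \sum_k dinj k ((s : S) *: (c k : C)) : tuples).
  move=> a s s'; rewrite scaler_sumr -big_split; apply: eq_bigr => k _.
  rewrite -[(a *: s + s' : S)]/(a * s + s') scalerDl -scalerA; exact: linearP.
have elin : linear (fun s : S^o => (s : S) *: e).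
  by move=> a s s'; rewrite scalerA -scalerDl.
have [|h hE] := injective_factor (B := mklinear lin) (f := mklinear elin) Ei.
  (* S -> C^K is injective: if [s] kills the generators of C over R, it kills C, because the two
     actions commute. *)
  move=> s s0; suff -> : s = 0 by rewrite linear0.
  apply: left_faithful => x; have [r ->] := cp.1 x.
  rewrite scaler_right_sum big1 // => k _.
  have /= := congr1 (fun z : tuples => coord z k) s0.
  by rewrite (coord_dsum_tuple (M := fun=> bimod_left C) (fun k => (s : S) *: (c k : C))) => ->; rewrite coord0; apply: scaler0.
exists (fun k => h \o dinj k : {linear bimod_left C -> E}).
have := hE (1 : S^o); rewrite /= scale1r => <-.
by rewrite linear_sum; apply: eq_bigr => k _; rewrite scale1r.
Qed.

(* Apply Hom(-, E) to the exact sequence S -> C^K -> C^L, which is Hom(-, C)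
   applied to the presentation of C over R. *)
Lemma injective_relations (L : finType) (b : L -> K -> R^c) (alpha : K -> homC C E) :
    (forall r : K -> R^c, \sum_k r k *: c k = 0 ->
      exists s : L -> R^c, forall k, r k = \sum_l s l * b l k) ->
    \sum_k hc_fun (alpha k) (c k) = 0 ->
  exists beta : L -> homC C E, forall k, alpha k = \sum_l (b l k : R) *: beta l.
Proof.
move=> bS alpha0.
pose Bl (d : tuples) l : C := \sum_k bimod_act (coord d k) (b l k).
have Blin : linear (fun d => \sum_l dinj l (Bl d l) : dsum (fun _ : L => bimod_left C)).
  have BlD a d d' l : Bl (a *: d + d') l = a *: Bl d l + Bl d' l.
    rewrite scaler_sumr -big_split; apply: eq_bigr => k _.
    by rewrite coordD coordZ bimod_actDl bimod_actZ.
  move=> a d d'; rewrite scaler_sumr -big_split; apply: eq_bigr => l _.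
  by rewrite BlD; exact: linearP.
have alin : linear (fun d : tuples => \sum_k hc_fun (alpha k) (coord d k)).
  move=> a d d'; rewrite scaler_sumr -big_split; apply: eq_bigr => k _ /=.
  by rewrite coordD coordZ /hc_fun linearP.
have [|h hE] := injective_factor (B := mklinear Blin) (f := mklinear alin) Ei.
  move=> d d0 /=.
  have dl l : Bl d l = 0.
    have /= := congr1 (fun z : dsum (fun _ : L => bimod_left C) => coord z l) d0.
    by rewrite (coord_dsum_tuple (M := fun=> bimod_left C) (Bl d)) coord0.
  (* Exactness at C^K: a tuple satisfying the relations of [c] defines an R-endomorphism of C, which
     is multiplication by some [s]; the tuple is (s c_k)_k. *)
  have [|f fE] := presented_lift (N := bimod_right C) (w := fun k => coord d k : bimod_right C) cp.1.
    move=> r /bS[s sE]; under eq_bigr do rewrite sE scaler_suml.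
    rewrite exchange_big big1 // => l _; under eq_bigr do rewrite -scalerA.
    by rewrite -scaler_sumr -[X in _ *: X]/(Bl d l : bimod_right C) dl; apply: scaler0.
  have [s [sE _]] := sd_left_homothety hC f.
  have dE k : coord d k = s *: (c k : C) by rewrite -sE fE.
  under eq_bigr do rewrite dE /hc_fun linearZ_LR.
  by rewrite -scaler_sumr -[X in _ *: X]/(\sum_k hc_fun (alpha k) (c k)) alpha0 scaler0.
exists (fun l => h \o dinj l : {linear bimod_left C -> E}) => k.
apply: homC_ext => x; rewrite homC_sum.
have aE : mklinear alin (dinj k x) = hc_fun (alpha k) x.
  rewrite -[LHS]/(\sum_j hc_fun (alpha j) (coord (dinj k x : tuples) j)) (bigD1 k) //.
  rewrite coord_in big1 => [|j /eqP jk]; first exact: addr0.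
  by rewrite coord_out ?/hc_fun ?linear0 // => /esym.
rewrite -aE -hE -[mklinear Blin _]/(\sum_l dinj l (Bl (dinj k x) l)) linear_sum.
apply: eq_bigr => l _; rewrite homCZ; congr (h (dinj l _)).
rewrite /Bl (bigD1 k) // coord_in big1 => [|j /eqP jk]; first exact: addr0.
rewrite coord_out; last by move=> /esym.
exact: bimod_act0.
Qed.

Variables (E' : lmodType S) (f : {linear homC C E -> homC C E'}).

(** This makes the induced map E -> E' well defined. Over the generators c the relation becomes one
    for [gamma], which factors as b beta by [injective_relations]; as [f] is R-linear, the
    coefficients b can be moved onto c, where they sum to 0. *)
Lemma hom_relations (I : finType) (alpha : I -> homC C E) (d : I -> C) :
  \sum_i hc_fun (alpha i) (d i) = 0 -> \sum_i hc_fun (f (alpha i)) (d i) = 0.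
Proof.
have /choice[r rE] : forall i, exists r : K -> R^c, (d i : bimod_right C) = \sum_k r k *: c k.
  by move=> i; apply: cp.1.
have sumE (E1 : lmodType S) (g : I -> homC C E1) :
    \sum_i hc_fun (g i) (d i) = \sum_k hc_fun (\sum_i (r i k : R) *: g i) (c k).
  under [RHS]eq_bigr do rewrite homC_sum.
  rewrite exchange_big; apply: eq_bigr => i _; rewrite rE.
  by rewrite /hc_fun (linear_sum (g i : {linear C -> E1})).
rewrite !sumE; set gamma := fun k => \sum_i (r i k : R) *: alpha i => gamma0.
have [_ [L [b [b0 bS]]]] := cp.
have [beta betaE] := injective_relations bS gamma0.
have {}betaE k : gamma k = \sum_l (b l k : R) *: beta l by exact: betaE.
transitivity (\sum_k hc_fun (f (gamma k)) (c k)).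
  apply: eq_bigr => k _; rewrite linear_sum; congr (hc_fun _ _).
  by apply: eq_bigr => i _; rewrite linearZ_LR.
under eq_bigr do rewrite betaE linear_sum homC_sum.
rewrite exchange_big big1 // => l _.
under eq_bigr do rewrite linearZ_LR homCZ.
transitivity (hc_fun (f (beta l)) (\sum_k b l k *: c k : C)).
  exact: (esym (linear_sum (f (beta l) : {linear bimod_left C -> E'}) _ _ _)).
by rewrite b0; exact: (linear0 (f (beta l) : {linear bimod_left C -> E'})).
Qed.

(* In other words E = C (x) Hom_S(C, E) when E is injective. *)
Lemma hom_of_homs : exists h : {linear E -> E'},
  forall alpha x, hc_fun (f alpha) x = h (hc_fun alpha x).
Proof.
have [alpha alphaE] := choice injective_evaluations.
pose h e := \sum_k hc_fun (f (alpha e k)) (c k).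
(* Independence of the decomposition: the difference between the chosen one and any other is a
   relation, and [f] preserves relations. *)
have hE (I : finType) (ga : I -> homC C E) (d : I -> C) :
    h (\sum_i hc_fun (ga i) (d i)) = \sum_i hc_fun (f (ga i)) (d i).
  set e := \sum_i _; apply/eqP; rewrite -subr_eq0; apply/eqP.
  have := @hom_relations (K + I)%type
    (fun j => match j with inl k => alpha e k | inr i => - ga i end)
    (fun j => match j with inl k => c k : C | inr i => d i end).
  rewrite !big_sumType /= -alphaE.
  have -> : \sum_i hc_fun (- ga i) (d i) = - e by rewrite -sumrN; apply: eq_bigr.
  rewrite subrr => /(_ erefl) H; rewrite -[RHS]H; congr (_ + _).
  by rewrite -sumrN; apply: eq_bigr => i _; rewrite linearN.
have h1 ga x : h (hc_fun ga x) = hc_fun (f ga) x.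
  have := hE 'I_1 (fun=> ga) (fun=> x); by rewrite !big_ord1.
have lin : linear h.
  move=> a e e'.
  have E0 : a *: e + e' = \sum_j (match j : K + K with
     inl k => hc_fun (alpha e k) (a *: (c k : C)) | inr k => hc_fun (alpha e' k) (c k) end).
    rewrite big_sumType /= -alphaE {1}(alphaE e) scaler_sumr; congr (_ + _).
    by apply: eq_bigr => k _; rewrite /hc_fun linearZ_LR.
  rewrite E0.
  have := hE (K + K)%type (fun j => match j with inl k => alpha e k | inr k => alpha e' k end)
    (fun j => match j with inl k => a *: (c k : C) | inr k => c k : C end).
  rewrite !big_sumType /= => ->; congr (_ + _).
  by rewrite /h scaler_sumr; apply: eq_bigr => k _; rewrite /hc_fun linearZ_LR.
by exists (mklinear lin) => ga x; rewrite /= h1.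
Qed.
End HomFromInjective.

Lemma injective_hom_ext (E E' : lmodType S) (h h' : {linear E -> E'}) :
  injective_module E -> (forall (alpha : homC C E) x, h (hc_fun alpha x) = h' (hc_fun alpha x)) ->
  h =1 h'.
Proof.
move=> Ei hh' e; have [K [c cp]] := right_presented hC.
have [alpha ->] := injective_evaluations Ei cp e.
by rewrite !linear_sum; apply: eq_bigr => k _; apply: hh'.
Qed.

Lemma left_hom_full (E E' : lmodType S) (f : {linear homC C E -> homC C E'}) :
  injective_module E -> exists h : {linear E -> E'},
  forall alpha x, hc_fun (f alpha) x = h (hc_fun alpha x).
Proof.
move=> Ei; have [K [c cp]] := right_presented hC; exact: (hom_of_homs Ei cp).
Qed.
End InjectiveClass.
Arguments homC_post {S R C E E'} h.

(** * Closure properties of I_C *)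

Section InjectiveClosure.
Variables (S R : pzRingType) (C : bimodule S R).
Hypothesis hC : semidualizing C.

(** The idempotent [i \o p] of N gives an endomorphism [f] of Hom_S(C, E), hence an endomorphism [e]
    of E, which is idempotent by uniqueness. Its fixed points form a retract of E and are the
    injective module sought. *)
Lemma injective_C_summands : closed_under_direct_summands (injective_C C).
Proof.
move=> K N [E Ei /left_homP[phi [phi0 phiS]]] [K' [g gbij]].
have [g' gK g'K] := gbij.
have g'lin : linear g' by exact: can2_linear gK g'K.
have ilin : linear (fun x : K => g (x, 0)).
  move=> a x y; rewrite -linearP; congr (g _).
  by rewrite -[RHS]/(a *: x + y, a *: 0 + 0) scaler0 addr0.
have plin : linear (fun z => (g' z).1) by move=> a x y; rewrite g'lin.
pose i : {linear K -> N} := mklinear ilin.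
pose p : {linear N -> K} := mklinear plin.
have pi x : p (i x) = x by rewrite /= gK.
have phiI x y : phi x = phi y -> x = y.
  by move=> E'; apply/eqP; rewrite -subr_eq0; apply/eqP/phi0; rewrite linearB E' subrr.
have [psi psiE] := choice phiS.
have psilin : linear psi.
  by move=> a x y; apply: phiI; rewrite psiE linearP !psiE.
pose f : {linear homC C E -> homC C E} := phi \o i \o p \o mklinear psilin.
have fE x : f (phi x) = phi (i (p x)) by rewrite /=; congr (phi (i (p _))); apply: phiI; rewrite psiE.
have [e eE] := left_hom_full hC f Ei.
have ff alpha : f (f alpha) = f alpha.
  by have [x <-] := phiS alpha; rewrite !fE pi.
have ee : forall v, e (e v) = e v.
  apply: (injective_hom_ext hC (h := e \o e : {linear _ -> _}) Ei) => alpha x /=.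
  by rewrite -!eE ff.
have fix0 : e 0 = 0 by rewrite linear0.
have fixD x y : e x = x -> e y = y -> e (x + y) = x + y by rewrite linearD => -> ->.
have fixZ a x : e x = x -> e (a *: x) = a *: x by rewrite linearZ_LR => ->.
pose P := Submod fix0 fixD fixZ.
exists (submod_of P).
  apply: (injective_retract (i := submod_val P) (p := corestr (P := P) (f := e) ee) _ Ei) => x.
  by apply: submod_of_eq; exact: svalP x.
apply/left_homP.
have Pval x c : P (hc_fun (phi (i x)) c).
  by rewrite /= -eE fE pi.
have hlin x : linear (fun c : C => exist _ _ (Pval x c) : submod_of P).
  by move=> a c c'; apply: submod_of_eq; rewrite /= /hc_fun linearP.
have Hlin : linear (fun x => mklinear (hlin x) : homC C (submod_of P)).
  move=> a x y; apply: homC_ext => c; apply: submod_of_eq.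
  have E' : phi (i (a *: x + y)) = a *: phi (i x) + phi (i y) by rewrite !linearP.
  exact: (congr1 (fun f => hc_fun f c) E').
exists (mklinear Hlin); split=> [x x0|h].
  rewrite -(pi x) (_ : i x = 0) ?linear0 //; apply: phi0; apply: homC_ext => c.
  exact: (congr1 (fun f : homC C (submod_of P) => sval (hc_fun f c)) x0).
have [m mE] := phiS (homC_post (submod_val P) h).
exists (p m); apply: homC_ext => c; apply: submod_of_eq.
rewrite -[LHS]/(hc_fun (phi (i (p m))) c) -fE eE mE homC_postE.
exact: (svalP (hc_fun h c)).
Qed.

Hypothesis Sn : left_noetherian S.

Lemma injective_C_coproducts : closed_under_coproducts (injective_C C).
Proof.
move=> I N L g NI Lcop.
have /dep_choice[E EE] : forall i, exists E, injective_module E /\ is_left_hom C E (N i).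
  by move=> i; case: (NI i) => E; exists E.
have Ei i := (EE i).1; have Eh i := (left_homP _ _ _).1 (EE i).2.
have {Eh}[phi phiE] := dep_choice Eh.
exists (dsum E); first exact: noetherian_injective_dsum.
apply/left_homP.
have [Phi [PhiE _]] := Lcop _ (fun i => homC_post (dinj i) \o phi i : {linear _ -> homC C (dsum E)}).
(* [L] has no coordinates of its own; comparison with the concrete [dsum N] supplies them. *)
have [h [hE _]] := Lcop _ (fun i => dinj i : {linear _ -> dsum N}).
have [e [_ eU]] := Lcop _ g.
have h'h z : dllift g (h z) = z.
  rewrite -[LHS]/((dllift g \o h : {linear _ -> _}) z) (eU (dllift g \o h : {linear _ -> _})).
    by rewrite -(eU idfun).
  by move=> i x; rewrite -[LHS]/(dllift g (h (g i x))) hE dllift_inj.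
have coordPhi i c (y : dsum N) :
    coord (hc_fun (Phi (dllift g y)) c) i = hc_fun (phi i (coord y i)) c.
  move: y; apply: (dsum_ext' (h := fun y => coord (hc_fun (Phi (dllift g y)) c) i)
    (h' := fun y => hc_fun (phi i (coord y i)) c)) => [x y|x y|j x].
  - by rewrite !linearD.
  - by rewrite coordD linearD.
  rewrite dllift_inj PhiE -[LHS]/(coord (dinj j (hc_fun (phi j x) c)) i).
  have [<-|ji] := pselect (j = i); first by rewrite !coord_in.
  by rewrite !coord_out // linear0.
exists Phi; split=> [z z0|f].
  rewrite -(h'h z) (_ : h z = 0) ?linear0 //; apply: dsum_eq => i.
  apply: (phiE i).1; apply: homC_ext => c.
  by rewrite -coordPhi h'h z0 homC0.
(* Surjectivity: the generators of C over S have values in finitely many summands, so [f] is the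
   finite sum of its components. *)
have [K [d [dS _]]] := left_presented hC.
have [s [us sf]] := common_support (fun k => hc_fun f (d k)).
have /dep_choice[x xE] : forall i, exists x, phi i x = homC_post (dproj E i) f.
  by move=> i; apply: (phiE i).2.
exists (\sum_(i <- s) g i (x i)); apply: homC_ext => c; move: c.
apply: (generators_ext (f := Phi _ : {linear bimod_left C -> dsum E})
  (g := f : {linear bimod_left C -> dsum E}) dS) => k.
rewrite -[RHS]/(hc_fun f (d k)) (dsum_decomp us (sf k)) linear_sum.
rewrite -[LHS]/(hc_fun _ (d k)) homC_sum; apply: eq_bigr => i _.
by rewrite PhiE -[LHS]/(dinj i (hc_fun (phi i (x i)) (d k))) xE.
Qed.

(** The given diagram lives on the R-side. Fullness of Hom_S(C, -) on injectives lifts its maps to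
    the E i and uniqueness makes the lifts functorial, so that a colimit of the E i can be
    formed. *)
Lemma injective_C_filtered_colimits : closed_under_filtered_colimits (injective_C C).
Proof.
move=> J D L g hJ DI Lcol.
have /dep_choice[E EE] : forall i, exists E, injective_module E /\ is_left_hom C E (D i).
  by move=> i; case: (DI i) => E; exists E.
have Ei i := (EE i).1; have Eh i := (left_homP _ _ _).1 (EE i).2.
have {Eh}[phi phiE] := dep_choice Eh.
have phiI i x y : phi i x = phi i y -> x = y.
  move=> E'; apply/eqP; rewrite -subr_eq0; apply/eqP/(phiE i).1.
  by rewrite linearB E' subrr.
(* Packing source, target and arrow into one index lets a single choice select all the lifted
   maps. *)
have /dep_choice[m mE] : forall q : {i & {j & @cat_hom J i j}},
    exists h : {linear E (projT1 q) -> E (projT1 (projT2 q))}, forall x c,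
      hc_fun (phi _ (diag_map D (projT2 (projT2 q)) x)) c = h (hc_fun (phi _ x) c).
  move=> [i [j u]] /=.
  have [psi psiE] := choice (phiE i).2.
  have psilin : linear psi.
    by move=> a x y; apply: phiI; rewrite psiE linearP !psiE.
  have [h hE] := left_hom_full hC (phi j \o diag_map D u \o mklinear psilin : {linear _ -> _}) (Ei i).
  by exists h => x c; rewrite -hE /=; congr (hc_fun (phi j (diag_map D u _)) c); apply: phiI; rewrite psiE.
pose emap i j (u : @cat_hom J i j) : {linear E i -> E j} := m (existT _ i (existT _ j u)).
have emapE i j (u : @cat_hom J i j) x c :
    hc_fun (phi j (diag_map D u x)) c = emap i j u (hc_fun (phi i x) c).
  exact: (mE (existT _ i (existT _ j u)) x c).
have eext i (E' : lmodType S) (h h' : {linear E i -> E'}) :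
    (forall x c, h (hc_fun (phi i x) c) = h' (hc_fun (phi i x) c)) -> h =1 h'.
  move=> hh'; apply: (injective_hom_ext hC (Ei i)) => alpha c.
  by have [x <-] := (phiE i).2 alpha.
have e_id i x : emap i i (cat_id i) x = x.
  by move: x; apply: (eext i _ _ idfun) => x c; rewrite -emapE diag_map_id.
have e_comp i j k (u : @cat_hom J i j) (v : @cat_hom J j k) x :
    emap i k (cat_comp u v) x = emap j k v (emap i j u x).
  move: x; apply: (eext i _ _ (emap j k v \o emap i j u : {linear _ -> _})) => x c /=.
  by rewrite -!emapE diag_map_comp.
pose DE := @Diagram S J E emap e_id e_comp.
have [M [ge geM]] := elt_colimit_exists hJ DE; have [gec geS ge0] := geM.
exists M; first exact: (noetherian_injective_colimit Sn hJ geM).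
apply/left_homP.
have Pc : is_cocone (D := D) (fun i => homC_post (ge i) \o phi i : {linear _ -> homC C M}).
  move=> i j u x; apply: homC_ext => c.
  by rewrite -[LHS]/(ge j (hc_fun (phi j (diag_map D u x)) c)) emapE; exact: (gec i j u).
have [Phi [PhiE _]] := Lcol.2 _ _ Pc.
have [gc gS g0] := colimit_elt hJ Lcol.
have [K [d dp]] := left_presented hC.
(* Injectivity holds because C is finitely generated over S ([hom_vanish]), surjectivity because it
   is finitely presented ([hom_lift]). *)
exists Phi; split=> [z|f].
  have [j [x ->]] := gS z; rewrite PhiE => x0.
  have [|k [u uE]] := hom_vanish geM (psi := phi j x : {linear bimod_left C -> DE j}) dp.1.
    by move=> c; exact: (congr1 (fun f : homC C M => hc_fun f c) x0).
  rewrite -(gc _ _ u) (_ : diag_map D u x = 0) ?linear0 //.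
  apply: (phiE k).1; apply: homC_ext => c; rewrite emapE; exact: uE.
have [j [psi psiE]] := hom_lift hJ geM (f : {linear bimod_left C -> M}) dp.
have [x xE] := (phiE j).2 (psi : homC C (E j)).
exists (g j x); rewrite PhiE; apply: homC_ext => c.
rewrite -[LHS]/(ge j (hc_fun (phi j x) c)) xE; exact: (esym (psiE c)).
Qed.
End InjectiveClosure.

Lemma flat_eqflatP (R : pzRingType) (F : lmodType R) : flat F <-> eqflat F.
Proof. by split; [exact: flat_eqflat | exact: eqflat_flat]. Qed.

Theorem proposition5p5 (R S : pzRingType) (C : bimodule S R)
    (hC : semidualizing C) :
  ([/\ closed_under_coproducts (flat_C C),
       closed_under_filtered_colimits (flat_C C)
     & closed_under_direct_summands (flat_C C)] /\
   (right_coherent R -> closed_under_products (flat_C C))) /\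
  (closed_under_coproducts (projective_C C) /\
   closed_under_direct_summands (projective_C C)) /\
  ((closed_under_products (injective_C C) /\
    closed_under_direct_summands (injective_C C)) /\
   (left_noetherian S ->
    closed_under_coproducts (injective_C C) /\
    closed_under_filtered_colimits (injective_C C))).
Proof.
have flatE : flat_C C = tensor_class C (@eqflat R).
  apply: funext => M; apply: propext.
  by split=> -[F /flat_eqflatP Ff FM]; exists F.
rewrite !flatE; split; [split|split; split].
- split; first exact: tensor_class_coproducts (@eqflat_dsum R).
    exact: tensor_class_filtered_colimits.
  by apply: tensor_class_summands => // E F i p pi; apply: eqflat_retract pi.
- by move=> Rc; apply: tensor_class_products => // I F; apply: eqflat_prod.
- exact: tensor_class_coproducts (@projective_dsum R).
- apply: (tensor_class_summands hC); first exact: projective_eqflat.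
  by move=> E F i p pi; apply: projective_retract pi.
- by split; [exact: injective_C_products | exact: injective_C_summands].
- by move=> Sn; split; [exact: injective_C_coproducts | exact: injective_C_filtered_colimits].
Qed.
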